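(* Let $\phi$ be a linear fractional map with $\phi(\mathbb{D})\subset\mathbb{D}$ and with no fixed point in $\mathbb{D}$, and let $\nu\in\mathbb{R}$. If $\phi$ is hyperbolic and is not an automorphism of $\mathbb{D}$, then $C_\phi$ is recurrent on $\mathcal{S}_\nu$ if and only if $\nu<1/2$.
   Context: $\mathbb{D}$ is the open unit disk of $\mathbb{C}$. For $\nu\in\mathbb{R}$, the weighted Dirichlet space $\mathcal{S}_\nu$ is the Hilbert space of analytic functions $f(z)=\sum_{n\ge 0}a_nz^n$ on $\mathbb{D}$ with $\|f\|_\nu^2=\sum_{n\ge0}|a_n|^2(n+1)^{2\nu}<\infty$. For a self-map $\phi$ of $\mathbb{D}$, $C_\phi f=f\circ\phi$; it is known that $C_\phi$ is bounded on every $\mathcal{S}_\nu$ when $\phi$ is a linear fractional self-map of $\mathbb{D}$. A bounded linear operator $T$ on a Hilbert space $\mathcal{H}$ is recurrent if for every non-empty open $U\subset\mathcal{H}$ there is a positive integer $n$ with $T^n(U)\cap U\neq\emptyset$. A linear fractional map ($\phi(z)=\frac{az+b}{cz+d}$, $ad-bc\ne0$) other than the identity with two distinct fixed points in $\hat{\mathbb{C}}=\mathbb{C}\cup\{\infty\}$ is conjugate (by a linear fractional map) to a dilation $z\mapsto\mu z$; it is hyperbolic if $\mu>0$ (with $\mu\neq1$). *)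

(* Defs.v *)
From HB Require Import structures.
From mathcomp Require Import all_boot all_order all_algebra.
From mathcomp Require Import complex ring.
From mathcomp Require Import all_classical all_reals all_analysis.
Import Order.TTheory GRing.Theory Num.Theory.
Import numFieldNormedType.Exports.
Set Implicit Arguments.
Unset Strict Implicit.
Unset Printing Implicit Defensive.
Local Open Scope classical_set_scope.
Local Open Scope ring_scope.
Local Open Scope complex_scope.

Import ComplexField.Normc.

(* An analytic function on the unit disk is represented by the sequence of its
   Taylor coefficients at 0; see [fval] for the function itself. *)

Section DirichletSpace.
Variables (R : realType) (nu : R).
Implicit Types a b : nat -> R[i].

Definition dterm a : R^nat :=
  fun n => normc (a n) ^+ 2 * n.+1%:R `^ (2 * nu).

Definition dirichlet_seq : {pred (nat -> R[i])} :=
  [pred a | `[< cvgn (series (dterm a)) >]].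

Lemma dirichlet_seqP a :
  reflect (cvgn (series (dterm a))) (a \in dirichlet_seq).
Proof. exact: asboolP. Qed.

Record dirichlet_space := DirichletSpace
  { dcoef :> nat -> R[i]; _ : dcoef \in dirichlet_seq }.

HB.instance Definition _ := [isSub for dcoef].
HB.instance Definition _ := [Choice of dirichlet_space by <:].

Lemma dterm_ge0 a n : 0 <= dterm a n.
Proof. by rewrite mulr_ge0 ?sqr_ge0 ?powR_ge0. Qed.

Lemma normc_nneg (z : R[i]) : 0 <= normc z.
Proof. by case: z => x y /=; rewrite sqrtr_ge0. Qed.

Lemma dtermZ c a : dterm (c *: a) = normc c ^+ 2 *: dterm a.
Proof. by apply/funext => n; rewrite /dterm /= normcM exprMn -mulrA. Qed.

Lemma dtermD s t a b n : 0 < s -> 0 < t ->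
  dterm (a + b) n <= (s + t) * (dterm a n / s + dterm b n / t).
Proof.
move=> s0 t0; rewrite /dterm.
set w := (_ `^ _); have w0 : 0 <= w by exact: powR_ge0.
have -> : (a + b) n = a n + b n by [].
set x := normc (a n); set y := normc (b n).
have xy : normc (a n + b n) ^+ 2 <= (x + y) ^+ 2.
  rewrite ler_pXn2r // ?nnegrE ?addr_ge0 ?normc_nneg //.
  exact: le_normcD.
apply: le_trans (ler_wpM2r w0 xy) _.
rewrite -subr_ge0.
have -> : (s + t) * (x ^+ 2 * w / s + y ^+ 2 * w / t) - (x + y) ^+ 2 * w =
    (t * x - s * y) ^+ 2 * (w / (s * t)).
  by field; apply/andP; split; rewrite gt_eqF.
apply: mulr_ge0; first exact: sqr_ge0.
by apply: divr_ge0 => //; apply: mulr_ge0; exact: ltW.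
Qed.

Lemma cvg_dtermZ c a : cvgn (series (dterm a)) -> cvgn (series (dterm (c *: a))).
Proof. by move=> ca; rewrite dtermZ; exact: is_cvg_seriesZ. Qed.

Lemma dtermD_bound s t a b : 0 < s -> 0 < t ->
  cvgn (series (dterm a)) -> cvgn (series (dterm b)) ->
  cvgn (series (dterm (a + b))) /\
  limn (series (dterm (a + b))) <=
    (s + t) * (limn (series (dterm a)) / s + limn (series (dterm b)) / t).
Proof.
move=> s0 t0 ca cb.
pose v : R^nat := (s + t) *: (s^-1 *: dterm a + t^-1 *: dterm b).
have csa : cvgn (series (s^-1 *: dterm a)) by exact: is_cvg_seriesZ.
have ctb : cvgn (series (t^-1 *: dterm b)) by exact: is_cvg_seriesZ.
have cD := is_cvg_seriesD csa ctb.
have cv : cvgn (series v) by exact: is_cvg_seriesZ.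
have le_v n : dterm (a + b) n <= v n.
  apply: le_trans (dtermD a b n s0 t0) _.
  by rewrite [dterm a n / s]mulrC [dterm b n / t]mulrC; exact: lexx.
have cab : cvgn (series (dterm (a + b))).
  apply: (series_le_cvg _ _ le_v cv) => n; first exact: dterm_ge0.
  exact: le_trans (dterm_ge0 _ _) (le_v n).
split=> //.
apply: le_trans (lim_series_le cab cv le_v) _.
rewrite lim_seriesZ // lim_seriesD // !lim_seriesZ //.
by rewrite [_ / s]mulrC [_ / t]mulrC; exact: lexx.
Qed.

Fact dirichlet_seq_submod : submod_closed dirichlet_seq.
Proof.
have cZ c a : a \in dirichlet_seq -> c *: a \in dirichlet_seq.
  by move=> /dirichlet_seqP ca; apply/dirichlet_seqP; exact: cvg_dtermZ.
have c0 : (0 : nat -> R[i]) \in dirichlet_seq.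
  apply/dirichlet_seqP.
  rewrite -[X in dterm X](scale0r (0 : nat -> R[i])) dtermZ normc0 expr0n /=.
  rewrite scale0r; rewrite (_ : series 0 = cst 0); first exact: is_cvg_cst.
  by apply/funext => n; rewrite /series /= big1.
split=> [//|c a b ain bin]; have := cZ c _ ain; move: bin.
move=> /dirichlet_seqP cb /dirichlet_seqP ca; apply/dirichlet_seqP.
by have [] := @dtermD_bound 1 1 _ _ ltr01 ltr01 ca cb.
Qed.

HB.instance Definition _ :=
  GRing.isSubmodClosed.Build _ _ dirichlet_seq dirichlet_seq_submod.
HB.instance Definition _ :=
  [SubChoice_isSubLmodule of dirichlet_space by <:].

Implicit Types f g : dirichlet_space.

Lemma dcoef_is_cvg f : cvgn (series (dterm f)).
Proof. exact/dirichlet_seqP/valP. Qed.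

Definition dnorm f : R := Num.sqrt (limn (series (dterm f))).

Lemma dlim_ge0 f : 0 <= limn (series (dterm f)).
Proof.
apply: limr_ge; first exact: dcoef_is_cvg.
by apply: nearW => n; rewrite sumr_ge0 // => i _; exact: dterm_ge0.
Qed.

Lemma dnormZ c f : dnorm (c *: f) = normc c * dnorm f.
Proof.
rewrite /dnorm [dcoef _](_ : _ = c *: (f : nat -> R[i])) // dtermZ.
rewrite lim_seriesZ; last exact: dcoef_is_cvg.
by rewrite sqrtrM ?sqr_ge0 // sqrtr_sqr ger0_norm ?normc_nneg.
Qed.

Lemma dnorm0_eq0 f : dnorm f = 0 -> f = 0.
Proof.
move=> /eqP; rewrite sqrtr_eq0 => le0; apply/val_inj/funext => n /=.
have : dterm f n <= 0.
  apply: le_trans le0; apply: limr_ge; first exact: dcoef_is_cvg.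
  near=> m; have nm : (n < m)%N by near: m; exact: nbhs_infty_gt.
  rewrite /series /= (bigD1_seq n) ?mem_index_iota ?iota_uniq //=.
  by rewrite lerDl sumr_ge0 // => i _; exact: dterm_ge0.
rewrite /dterm pmulr_lle0 ?powR_gt0 ?ltr0n // => h.
by apply/eq0_normc/eqP; rewrite -sqrf_eq0 eq_le h sqr_ge0.
Unshelve. all: by end_near. Qed.

Lemma dnormD f g : dnorm (f + g) <= dnorm f + dnorm g.
Proof.
apply/ler_addgt0Pr => e e0.
have e20 : 0 < e / 2 by rewrite divr_gt0.
pose s := dnorm f + e / 2; pose t := dnorm g + e / 2.
have s0 : 0 < s by rewrite ltr_wpDl ?sqrtr_ge0.
have t0 : 0 < t by rewrite ltr_wpDl ?sqrtr_ge0.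
have -> : dnorm f + dnorm g + e = s + t.
  by rewrite /s /t addrACA -splitr.
have cf : cvgn (series (dterm f)) by exact: dcoef_is_cvg.
have cg : cvgn (series (dterm g)) by exact: dcoef_is_cvg.
have [_ le1] := dtermD_bound s0 t0 cf cg.
have boundf h r : 0 < r -> dnorm h <= r -> limn (series (dterm h)) / r <= r.
  move=> r0 hr; rewrite ler_pdivrMr // -expr2 -[leLHS]sqr_sqrtr ?dlim_ge0 //.
  by apply: lerXn2r; rewrite ?nnegrE ?sqrtr_ge0 // ltW.
have st0 : 0 < s + t by rewrite addr_gt0.
rewrite -[leRHS]gtr0_norm // -sqrtr_sqr /dnorm.
rewrite [dcoef _](_ : _ = (f : nat -> R[i]) + (g : nat -> R[i])) //.
rewrite ler_sqrt ?sqr_ge0 //; apply: le_trans le1 _.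
by rewrite expr2 ler_pM2l // lerD // boundf // lerDl ltW.
Qed.

(* As the scalar field is [R[i]], the normed module interface requires the norm
   to be [R[i]]-valued; its values are real. *)
Fact dnormC_ler_normD f g : (dnorm (f + g))%:C <= (dnorm f)%:C + (dnorm g)%:C.
Proof. by rewrite -rmorphD lecR dnormD. Qed.

Fact dnormC_normrZ c f : (dnorm (c *: f))%:C = `|c| * (dnorm f)%:C.
Proof. by rewrite dnormZ rmorphM. Qed.

Fact dnormC_normr0_eq0 f : (dnorm f)%:C = 0 -> f = 0.
Proof. by move=> [] /dnorm0_eq0. Qed.

HB.instance Definition _ := @Lmodule_isNormed.Build R[i] dirichlet_space
  (fun f => (dnorm f)%:C) dnormC_ler_normD dnormC_normrZ dnormC_normr0_eq0.

Lemma dirichlet_normE f : `|f| = (dnorm f)%:C.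
Proof. by []. Qed.

(* The power series converges whenever `|z| < 1, since the coefficients of an
   element of the space grow at most polynomially. *)
Definition fval f (z : R[i]) : R[i] :=
  limn (series (fun n => f n * z ^+ n : R[i]^o)).

End DirichletSpace.

Section LinearFractional.
Variable R : realType.

(* The Riemann sphere; [None] is the point at infinity. *)
Definition sphere := option R[i].

Implicit Types (phi psi : sphere -> sphere) (p q : sphere).

Definition mobius (a b c d : R[i]) (p : sphere) : sphere :=
  match p with
  | Some z => if c * z + d == 0 then None
              else Some ((a * z + b) / (c * z + d))
  | None => if c == 0 then None else Some (a / c)
  end.

Definition linear_fractional phi :=
  exists a b c d : R[i], a * d - b * c != 0 /\ phi =1 mobius a b c d.

Definition dilation (mu : R[i]) : sphere -> sphere := omap ( *%R mu).

(* The last clause is conjugacy to a dilation, i.e. psi \o phi \o psi^-1 is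
   z |-> mu z; note that linear fractional maps are bijections of the sphere. *)
Definition hyperbolic phi :=
  [/\ linear_fractional phi, ~ (phi =1 id),
      (exists p q, [/\ p <> q, phi p = p & phi q = q]) &
      exists mu : R, [/\ 0 < mu, mu != 1 &
        exists2 psi, linear_fractional psi &
          psi \o phi =1 dilation mu%:C \o psi]].

Definition disk : set sphere := Some @` [set z : R[i] | `|z| < 1].

(* Every holomorphic bijection of the disk onto itself is linear fractional. *)
Definition disk_automorphism phi :=
  linear_fractional phi /\ set_bij disk disk phi.

(* The function z |-> f (phi z) has at most one representative in the space; it
   has one whenever phi is a linear fractional self-map of the disk, so that the
   default value 0 is then never used. *)
Definition comp_op phi (nu : R) (f : dirichlet_space nu) : dirichlet_space nu :=
  xget 0 [set g | forall z w : R[i],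
    `|z| < 1 -> phi (Some z) = Some w -> fval g z = fval f w].

End LinearFractional.

Arguments disk : clear implicits.
Arguments comp_op {R} phi nu f.

Definition recurrent (H : topologicalType) (T : H -> H) :=
  forall U : set H, open U -> U !=set0 ->
    exists2 n, (0 < n)%N & (iter n T @` U) `&` U !=set0.

(* Main.v *)
(** Such a map phi has its attracting fixed point on the unit circle and the
    repelling one outside the closed disk. Hence, for some |a| = 1 and |b| < 1,
    the function W(z) = (1 - a z) / (1 - b z) satisfies W o phi = r W with
    0 < r < 1.

    If nu < 1/2, let k = 1 - b conj(a) and F_q = 1 / (q + k W) for q > 0. Then
    F_q o phi = F_{q/r} / r, so the orbit of F_q extends to a two-sided one,
    r^(-n) F_{q r^(-n)}; it tends to the constant 1/q in the future and to 0 in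
    the past, since q F_q -> 0 as q -> 0 exactly when nu < 1/2. If a vector y has
    a two-sided orbit (y_n) of this kind, then y - y_(-m) + y_(-2m) is close to y
    and is mapped by the 2m-th iterate to y_(2m) - y_m + y, also close to y. The
    span of the F_q is dense: its closure contains 1 and z / (1 - x z) for x
    tending to b, hence all Taylor coefficients in x of this family, hence
    the same functions for x in the largest disk around b inside the unit disk;
    moving the center to 0 yields all monomials.

    If nu >= 1/2, then |h(u) - h(v)| <= ||h|| |u - v| / (1 - max(|u|,|v|)^2), and
    the images u, v of two given points under phi^n satisfy |u - v| <= C r^n and
    1 - |u|^2, 1 - |v|^2 >= c r^n. So the functional h |-> h(u) - h(v) is bounded
    uniformly in n, while phi^n shrinks the corresponding difference of W by the
    factor r^n <= r: f and f o phi^n cannot both be close to W. *)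
Require Import Defs.
From mathcomp Require Import all_boot all_order all_algebra.
From mathcomp Require Import complex ring lra.
From mathcomp Require Import all_classical all_reals all_analysis.
Import Order.TTheory GRing.Theory Num.Theory.
Import numFieldNormedType.Exports.
Local Open Scope classical_set_scope.
Local Open Scope ring_scope.

Import ComplexField.Normc.
Set Implicit Arguments.
Unset Strict Implicit.
Unset Printing Implicit Defensive.
Local Open Scope complex_scope.

(** * The real-valued modulus of complex numbers *)

Section Modulus.
Variable R : realType.
Implicit Types z w : R[i].

Lemma normc_ltr z (r : R) : (`|z| < r%:C) = (normc z < r).
Proof. by rewrite normc_def ltcR; case: z. Qed.

Lemma normc_lt1 z : (`|z| < 1) = (normc z < 1).
Proof. exact: (normc_ltr z 1). Qed.

Lemma normcD z w : normc (z + w) <= normc z + normc w.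
Proof. exact: le_normcD. Qed.

Lemma normcNE z : normc (- z) = normc z.
Proof. exact: normcN. Qed.

Lemma normcC z w : normc (z - w) = normc (w - z).
Proof. by rewrite -normcNE opprB. Qed.

Lemma normcB z w : normc (z - w) <= normc z + normc w.
Proof. by rewrite -(normcNE w) normcD. Qed.

Lemma normcB_ge z w : normc z - normc w <= normc (z - w).
Proof. by rewrite lerBlDr -[z in leLHS](subrK w) normcD. Qed.

Lemma normcX z n : normc (z ^+ n) = normc z ^+ n.
Proof. by elim: n => [|n IHn]; rewrite ?normc1 // !exprS normcM IHn. Qed.

Lemma normc_real (x : R) : normc x%:C = `|x|.
Proof. by rewrite /= expr0n /= addr0 sqrtr_sqr. Qed.

Lemma normc_nat n : normc (n%:R : R[i]) = n%:R.
Proof. by rewrite -(rmorph_nat (real_complex R)) normc_real ger0_norm. Qed.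

Lemma sqr_normcE z : normc z ^+ 2 = complex.Re z ^+ 2 + complex.Im z ^+ 2.
Proof. by case: z => x y /=; rewrite sqr_sqrtr // addr_ge0 ?sqr_ge0. Qed.

Lemma normc_eq0 z : (normc z == 0) = (z == 0).
Proof. by apply/eqP/eqP => [/eq0_normc //|->]; exact: normc0. Qed.

Lemma normc_gt0 z : (0 < normc z) = (z != 0).
Proof. by rewrite lt_def normc_nneg andbT normc_eq0. Qed.

Lemma normc_sum (u : nat -> R[i]) m n :
  normc (\sum_(m <= k < n) u k) <= \sum_(m <= k < n) normc (u k).
Proof.
elim/big_rec2: _ => [|k x z _ le_zx]; first by rewrite normc0.
by apply: le_trans (normcD _ _) _; rewrite lerD2l.
Qed.

Lemma normc_le_ReIm z : normc z <= `|complex.Re z| + `|complex.Im z|.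
Proof.
rewrite -(@ler_pXn2r _ 2) ?nnegrE ?addr_ge0 ?normc_nneg // sqr_normcE.
rewrite sqrrD !real_normK ?num_real //.
by rewrite addrAC lerDl mulrn_wge0 // mulr_ge0.
Qed.

Lemma Re_le_normc z : `|complex.Re z| <= normc z.
Proof.
rewrite -(@ler_pXn2r _ 2) ?nnegrE ?normc_nneg // sqr_normcE.
by rewrite real_normK ?num_real // lerDl sqr_ge0.
Qed.

Lemma Im_le_normc z : `|complex.Im z| <= normc z.
Proof.
rewrite -(@ler_pXn2r _ 2) ?nnegrE ?normc_nneg // sqr_normcE.
by rewrite real_normK ?num_real // lerDr sqr_ge0.
Qed.

Lemma normc_small0 z : (forall e, 0 < e -> normc z < e) -> z = 0.
Proof.
move=> small; apply/eqP; rewrite -normc_eq0 eq_le normc_nneg andbT leNgt.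
by apply/negP => /small; rewrite ltxx.
Qed.

End Modulus.

(** * Geometric sums with polynomial weights *)

Section RealSums.
Variable R : realType.
Implicit Types (s t y : R) (n : nat).

Lemma sum_geo_le t m n : 0 <= t < 1 ->
  \sum_(m <= j < n) t ^+ j <= t ^+ m / (1 - t).
Proof.
move=> /andP[t0 t1]; have d0 : 0 < 1 - t by rewrite subr_gt0.
have [nm|mn] := leqP n m.
  by rewrite big_geq // divr_ge0 ?exprn_ge0 // ltW.
rewrite ler_pdivlMr // mulr_suml.
rewrite (@telescope_sumr_eq _ m n (fun j => - t ^+ j)) ?(ltnW mn) //.
  by rewrite opprK addrC gerBl exprn_ge0.
by move=> j _; rewrite exprS; ring.
Qed.

(** Each of the n + 1 terms of 1 + t + ... + t^n is at least t^n, and their sum is at most 1 / (1 -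
    t). *)
Lemma succn_mul_geo_le t n : 0 <= t < 1 -> n.+1%:R * t ^+ n <= (1 - t)^-1.
Proof.
move=> /[dup] t01 /andP[t0 t1].
apply: le_trans (_ : \sum_(0 <= j < n.+1) t ^+ j <= _); last first.
  by apply: le_trans (sum_geo_le _ _ t01) _; rewrite expr0 div1r.
rewrite mulr_natl -[n.+1 in leLHS]subn0 -sumr_const_nat big_nat_cond.
rewrite [leRHS]big_nat_cond; apply: ler_sum => j /andP[/andP[_ jn] _].
by apply: ler_wiXn2l => //; exact: ltW.
Qed.

(** With p = max(s, 1) and t = y^(1/p), the term is at most ((j + 1) t^j)^p, so the linear case
    suffices. *)
Lemma succn_powR_geo_le s y : 0 <= y < 1 ->
  exists C, forall j, j.+1%:R `^ s * y ^+ j <= C.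
Proof.
move=> /andP[y0 y1]; pose p := Num.max s 1.
have p0 : 0 < p by rewrite lt_max ltr01 orbT.
pose t := y `^ p^-1.
have t01 : 0 <= t < 1.
  have := @gt0_ltr_powR R p^-1 _ y 1; rewrite powR1 powR_ge0.
  by apply; rewrite ?invr_gt0 ?nnegrE.
exists ((1 - t)^-1 `^ p) => j.
have jp : j.+1%:R `^ s <= j.+1%:R `^ p :> R.
  by apply: ler_powR; rewrite ?ler1n // le_max lexx.
apply: le_trans (ler_wpM2r (exprn_ge0 _ y0) jp) _.
have -> : y ^+ j = (t ^+ j) `^ p.
  rewrite -!powR_mulrn ?powR_ge0 // -!powRrM /t.
  by rewrite mulrCA mulVf ?gt_eqF // mulr1.
case/andP: (t01) => t0 _; rewrite -powRM ?exprn_ge0 //.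
apply: ge0_ler_powR; rewrite ?nnegrE ?mulr_ge0 ?exprn_ge0 //.
- exact: ltW.
- by rewrite invr_ge0 subr_ge0 ltW //; case/andP: t01.
- exact: succn_mul_geo_le.
Qed.

(** Of the two factors sqrt(y)^j of y^j, one absorbs the weight and the other leaves a geometric
    series. *)
Lemma sum_powR_geo_le s y : 0 <= y < 1 ->
  exists C, forall n, \sum_(0 <= j < n) j.+1%:R `^ s * y ^+ j <= C.
Proof.
move=> /andP[y0 y1]; pose t := Num.sqrt y.
have t01 : 0 <= t < 1.
  by rewrite sqrtr_ge0 -sqrtr1 ltr_sqrt.
have [C leC] := succn_powR_geo_le s t01; exists (C / (1 - t)) => n.
case/andP: (t01) => t0 t1.
have C0 : 0 <= C by apply: le_trans (leC 0); rewrite mulr_ge0 ?powR_ge0 ?exprn_ge0.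
apply: le_trans (_ : \sum_(0 <= j < n) C * t ^+ j <= _).
  apply: ler_sum => j _.
  rewrite -[y]sqr_sqrtr // -/t -exprM mulnC exprM expr2 mulrA.
  by apply: ler_wpM2r (leC j); rewrite exprn_ge0.
rewrite -mulr_sumr; apply: ler_wpM2l => //.
by apply: le_trans (sum_geo_le _ _ t01) _; rewrite expr0 div1r.
Qed.

End RealSums.

(** * The norm of the weighted Dirichlet space *)

Section DirichletNorm.
Variables (R : realType) (nu : R).
Implicit Types (a : nat -> R[i]) (f g h : dirichlet_space nu).

Lemma series_dterm_homo a : {homo series (dterm nu a) : m n / (m <= n)%N >-> m <= n}.
Proof.
move=> m n mn; rewrite /series /= [leRHS](@big_cat_nat _ _ _ m) //= lerDl.
by apply: sumr_ge0 => j _; exact: dterm_ge0.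
Qed.

Lemma dirichlet_seq_bounded a (M : R) :
  (forall n, \sum_(0 <= j < n) dterm nu a j <= M) -> a \in dirichlet_seq nu.
Proof.
move=> leM; apply/dirichlet_seqP.
apply: nondecreasing_is_cvgn; first exact: series_dterm_homo.
by exists M => _ [n _ <-]; exact: leM.
Qed.

Lemma dnorm_ge0 f : 0 <= dnorm f.
Proof. exact: sqrtr_ge0. Qed.

Lemma sum_dterm_le f n : \sum_(0 <= j < n) dterm nu f j <= dnorm f ^+ 2.
Proof.
rewrite sqr_sqrtr ?dlim_ge0 //.
apply: (@nondecreasing_cvgn_le _ (series (dterm nu f))).
  exact: series_dterm_homo.
exact: dcoef_is_cvg.
Qed.

Lemma dnorm_le f (M : R) : 0 <= M ->
  (forall n, \sum_(0 <= j < n) dterm nu f j <= M ^+ 2) -> dnorm f <= M.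
Proof.
move=> M0 leM; rewrite -[leRHS]ger0_norm // -sqrtr_sqr ler_sqrt ?sqr_ge0 //.
apply: limr_le; first exact: dcoef_is_cvg.
by apply: nearW => n; exact: leM.
Qed.

Lemma dterm_le f j : dterm nu f j <= dnorm f ^+ 2.
Proof.
apply: le_trans (sum_dterm_le f j.+1); rewrite big_nat_recr //= lerDr.
by apply: sumr_ge0 => i _; exact: dterm_ge0.
Qed.

Lemma dnorm0 : dnorm (0 : dirichlet_space nu) = 0.
Proof.
apply/eqP; rewrite eq_le dnorm_ge0 andbT; apply: dnorm_le => // n.
by rewrite expr0n /= big1 // => j _; rewrite /dterm normc0 expr0n mul0r.
Qed.

Lemma dnormN f : dnorm (- f) = dnorm f.
Proof. by rewrite -scaleN1r Defs.dnormZ normcNE normc1 mul1r. Qed.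

Lemma dnormB f g : dnorm (f - g) <= dnorm f + dnorm g.
Proof. by rewrite -(dnormN g) Defs.dnormD. Qed.

Lemma dnorm_distC f g : dnorm (f - g) = dnorm (g - f).
Proof. by rewrite -dnormN opprB. Qed.

Lemma dcoefD f g j : (f + g) j = f j + g j. Proof. by []. Qed.
Lemma dcoefB f g j : (f - g) j = f j - g j. Proof. by []. Qed.
Lemma dcoefZ (c : R[i]) f j : (c *: f) j = c * f j. Proof. by []. Qed.
Lemma dcoef0 j : (0 : dirichlet_space nu) j = 0. Proof. by []. Qed.

Lemma dcoef_sum (F : nat -> dirichlet_space nu) m n j :
  (\sum_(m <= k < n) F k) j = \sum_(m <= k < n) F k j.
Proof. by elim/big_rec2: _ => //= k x y _ <-. Qed.

Lemma dirichlet_ext f g : (forall j, f j = g j) -> f = g.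
Proof. by move=> fg; apply/val_inj/funext. Qed.

(** A single term of the norm bounds |f_j|^2 by a multiple of (j + 1)^(-2 nu), which the geometric
    factor absorbs. *)
Lemma dcoef_geo_le f (y : R) : 0 <= y < 1 ->
  exists C, forall j, normc (f j) * y ^+ j <= C.
Proof.
move=> /andP[y0 y1].
have y201 : 0 <= y ^+ 2 < 1 by rewrite sqr_ge0 expr_lt1.
have [C leC] := succn_powR_geo_le (- (2 * nu)) y201.
have C0 : 0 <= C by apply: le_trans (leC 0); rewrite mulr_ge0 ?powR_ge0 ?exprn_ge0 ?sqr_ge0.
exists (Num.sqrt (dnorm f ^+ 2 * C)) => j.
rewrite -[leLHS]ger0_norm ?mulr_ge0 ?normc_nneg ?exprn_ge0 // -sqrtr_sqr.
rewrite ler_sqrt ?mulr_ge0 ?dnorm_ge0 // exprMn exprAC.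
have w0 : 0 < j.+1%:R `^ (2 * nu) :> R by rewrite powR_gt0.
have -> : normc (f j) ^+ 2 * y ^+ 2 ^+ j =
    dterm nu f j * (j.+1%:R `^ (- (2 * nu)) * y ^+ 2 ^+ j).
  by rewrite /dterm powRN mulrA mulfK ?lt0r_neq0.
apply: ler_pM.
- exact: dterm_ge0.
- by rewrite mulr_ge0 ?powR_ge0 ?exprn_ge0 ?sqr_ge0.
- exact: dterm_le.
- exact: leC.
Qed.

(** The constant [K] depends only on [nu] and the rate [y]. Explicit elements of the space are
    built, and their norms estimated, through this bound. *)
Lemma geo_dirichlet (y : R) : 0 <= y < 1 ->
  exists2 K, 0 <= K & forall a c, 0 <= c -> (forall j, normc (a j) <= c * y ^+ j) ->
    exists2 f : dirichlet_space nu, (forall j, f j = a j) & dnorm f <= c * K.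
Proof.
move=> /andP[y0 y1].
have y201 : 0 <= y ^+ 2 < 1 by rewrite sqr_ge0 expr_lt1.
have [C leC] := sum_powR_geo_le (2 * nu) y201.
have C0 : 0 <= C by apply: le_trans (leC 0); rewrite big_geq.
exists (Num.sqrt C); first exact: sqrtr_ge0.
move=> a c c0 leac.
have bound n : \sum_(0 <= j < n) dterm nu a j <= (c * Num.sqrt C) ^+ 2.
  rewrite exprMn sqr_sqrtr //.
  apply: le_trans (ler_wpM2l (sqr_ge0 c) (leC n)); rewrite mulr_sumr.
  apply: ler_sum => j _; rewrite /dterm mulrCA mulrC.
  apply: ler_wpM2l; first exact: powR_ge0.
  rewrite exprAC -exprMn ler_pXn2r ?nnegrE ?normc_nneg //.
  by rewrite mulr_ge0 ?exprn_ge0.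
have ain : a \in dirichlet_seq nu by exact: dirichlet_seq_bounded bound.
by exists (DirichletSpace ain) => //; apply: dnorm_le => //; rewrite mulr_ge0 ?sqrtr_ge0.
Qed.

(** The radius given by the normed structure lies in [R[i]]; being positive, it has zero imaginary
    part. *)
Lemma open_dball (U : set (dirichlet_space nu)) f : open U -> U f ->
  exists2 e : R, 0 < e & forall g, dnorm (f - g) < e -> U g.
Proof.
move=> oU Uf; have /nbhs_normP [e e0 eU] : nbhs f U by exact: open_nbhs_nbhs.
move: e0 => /=; case: e eU => e i eU; rewrite ltcE /= => /andP[/eqP i0 e0].
rewrite i0 in eU => {i i0}.
exists e => // g fg; apply: eU; rewrite /= dirichlet_normE.
by rewrite -[_ +i* _]/(e%:C) ltcR.
Qed.

Lemma dball_open f (e : R) : open [set g | dnorm (f - g) < e].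
Proof.
have [e0|e0] := ltP 0 e; last first.
  rewrite (_ : [set _ | _] = set0); first exact: open0.
  by apply/seteqP; split=> // g /=; rewrite ltNge (le_trans e0) ?dnorm_ge0.
have -> : [set g | dnorm (f - g) < e] = ball f (e%:C).
  apply/seteqP; split=> g /=; rewrite -ball_normE /= dirichlet_normE ltcR //.
by apply: ball_open; rewrite (ltcR 0).
Qed.

End DirichletNorm.

(** * Point values of power series *)

Section ComplexSeries.
Variable R : realType.
Implicit Types (u : nat -> R[i]) (S : R[i]).

(** Convergence with a real [e] and the real-valued [normc]; [tends_cvg] transfers it to the
    topological limit behind [fval]. *)
Definition tends u S := forall e : R, 0 < e ->
  exists N, forall n, (N <= n)%N -> normc (u n - S) < e.

Lemma tendsD u v S S' : tends u S -> tends v S' -> tends (u \+ v) (S + S').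
Proof.
move=> uS vS e e0; have e20 : 0 < e / 2 by rewrite divr_gt0.
have [N uN] := uS _ e20; have [N' vN] := vS _ e20; exists (maxn N N') => n.
rewrite geq_max => /andP[/uN un /vN vn] /=.
rewrite opprD addrACA [e]splitr; apply: le_lt_trans (normcD _ _) _.
exact: ltrD.
Qed.

Lemma tendsZ (c : R[i]) u S : tends u S -> tends (fun n => c * u n) (c * S).
Proof.
move=> uS e e0; have c0 : 0 < normc c + 1 by rewrite ltr_wpDl ?normc_nneg.
have [N uN] := uS (e / (normc c + 1)) (divr_gt0 e0 c0); exists N => n /uN un.
rewrite -mulrBr normcM; move: un; rewrite ltr_pdivlMr //.
apply: le_lt_trans; rewrite mulrC ler_wpM2l ?normc_nneg //.
by rewrite lerDl.
Qed.

Lemma tends_cvg u S : tends u S -> (u : nat -> R[i]^o) @ \oo --> (S : R[i]^o).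
Proof.
move=> uS; apply/(@cvgrPdist_lt _ R[i]^o) => e; case: e => e i.
rewrite ltcE /= => /andP[/eqP -> e0]; have [N uN] := uS _ e0.
exists N => // n Nn; rewrite -[_ +i* _]/(e%:C) normc_ltr normcC.
exact: uN.
Qed.

(** The real and imaginary parts are dominated by a geometric series, so both converge
    absolutely. *)
Lemma summable_tends u (y C : R) : 0 <= y < 1 ->
  (forall j, normc (u j) <= C * y ^+ j) ->
  exists S, tends (fun n => \sum_(0 <= j < n) u j) S.
Proof.
move=> y01 leC; have /andP[y0 y1] := y01.
have real_part (p : R[i] -> R) : (forall z, `|p z| <= normc z) ->
    cvgn (series (fun j => p (u j))).
  move=> le_p; apply: normed_cvg.
  apply: (@series_le_cvg _ _ (geometric C y)) => j /=.
  - exact: normr_ge0.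
  - exact: le_trans (normc_nneg _) (leC j).
  - exact: le_trans (le_p _) (leC j).
  - by apply: is_cvg_geometric_series; rewrite ger0_norm.
have cRe := real_part _ (@Re_le_normc R); have cIm := real_part _ (@Im_le_normc R).
pose x := limn (series (fun j => complex.Re (u j))).
pose z := limn (series (fun j => complex.Im (u j))).
exists (x +i* z)%C => e e0; have e20 : 0 < e / 2 by rewrite divr_gt0.
have /cvgrPdist_lt /(_ _ e20)[N _ uN] := cRe.
have /cvgrPdist_lt /(_ _ e20)[N' _ uN'] := cIm.
exists (maxn N N') => n; rewrite geq_max => /andP[/uN /= un /uN' /= un'].
apply: le_lt_trans (normc_le_ReIm _) _; rewrite [e]splitr.
have -> : \sum_(0 <= j < n) u j =
   (series (fun j => complex.Re (u j)) n +i* series (fun j => complex.Im (u j)) n)%C.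
  rewrite /series /=; elim: n {un un'} => [|n IHn]; first by rewrite !big_geq.
  by rewrite !big_nat_recr //= IHn; case: (u n).
by rewrite /= ltrD // distrC.
Qed.

End ComplexSeries.

Section Fval.
Variables (R : realType) (nu : R).
Implicit Types (f g : dirichlet_space nu) (z : R[i]).

Lemma fval_eq f z S : tends (fun n => \sum_(0 <= k < n) f k * z ^+ k) S -> fval f z = S.
Proof. by move/tends_cvg => fS; apply: cvg_lim fS; exact: norm_hausdorff. Qed.

(** With [y] the square root of |z|, one factor [y ^+ j] tames the coefficients and the other gives
    a geometric majorant. *)
Lemma fval_tends f z : normc z < 1 ->
  tends (fun n => \sum_(0 <= k < n) f k * z ^+ k) (fval f z).
Proof.
move=> z1; pose y := Num.sqrt (normc z).
have y01 : 0 <= y < 1 by rewrite sqrtr_ge0 -sqrtr1 ltr_sqrt.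
have [C leC] := dcoef_geo_le f y01.
suff [S fS] : exists S, tends (fun n => \sum_(0 <= k < n) f k * z ^+ k) S.
  by rewrite (fval_eq fS).
apply: (summable_tends (C := C) y01) => j.
rewrite normcM normcX -[normc z]sqr_sqrtr ?normc_nneg // -/y exprAC expr2 mulrA.
by apply: ler_wpM2r (leC j); rewrite exprn_ge0 ?sqrtr_ge0.
Qed.

Lemma fvalD f g z : normc z < 1 -> fval (f + g) z = fval f z + fval g z.
Proof.
move=> z1; apply: fval_eq; move: (tendsD (fval_tends f z1) (fval_tends g z1)).
congr tends; apply/funext => n /=; rewrite -big_split /=.
by apply: eq_bigr => k _; rewrite -mulrDl.
Qed.

Lemma fvalZ c f z : normc z < 1 -> fval (c *: f) z = c * fval f z.
Proof.
move=> z1; apply: fval_eq; move: (tendsZ c (fval_tends f z1)).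
congr tends; apply/funext => n /=; rewrite mulr_sumr.
by apply: eq_bigr => k _; rewrite mulrA.
Qed.

Lemma fvalB f g z : normc z < 1 -> fval (f - g) z = fval f z - fval g z.
Proof. by move=> z1; rewrite -scaleN1r fvalD // fvalZ // mulN1r. Qed.

Lemma fval0 z : normc z < 1 -> fval (0 : dirichlet_space nu) z = 0.
Proof. by move=> z1; rewrite -(subrr 0) fvalB // subrr. Qed.

End Fval.

(** * Vector-valued power series relative to a closed subspace [Y] *)

Section Taylor.
Variables (R : realType) (E : lmodType R[i]) (N : E -> R).
Hypothesis NZ : forall c u, N (c *: u) = normc c * N u.
Variable Y : E -> Prop.
Hypotheses (Y0 : Y 0) (Ylin : forall c u v, Y u -> Y v -> Y (c *: u + v))
  (Ycl : forall u, (forall e, 0 < e -> exists2 v, Y v & N (u - v) < e) -> Y u).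
Variables (v : nat -> E) (D M : R).
Hypotheses (D0 : 0 <= D) (M0 : 0 <= M).

(* [y] is the value at [t] of the power series with coefficients [v]. The
   geometric bounds on the remainders make completeness unnecessary. *)
Definition expansion (t : R[i]) (y : E) := forall n,
  N (y - \sum_(0 <= k < n) t ^+ k *: v k) <= D * (M * normc t) ^+ n.

Let Ysum t n : (forall k, (k < n)%N -> Y (v k)) -> Y (\sum_(0 <= k < n) t ^+ k *: v k).
Proof.
elim: n => [|n IHn] Yv; first by rewrite big_geq.
rewrite big_nat_recr //= addrC; apply: Ylin; first exact: Yv.
by apply: IHn => k kn; apply: Yv; rewrite ltnS ltnW.
Qed.

(** By strong induction: once the earlier coefficients lie in [Y], [v k] is the limit, as t tends to
    0, of t^(-k) (y - sum of the terms below k), which lies in [Y]. *)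
Lemma expansion_coef :
  (forall e, 0 < e -> exists t y, [/\ t != 0, normc t < e, Y y & expansion t y]) ->
  forall k, Y (v k).
Proof.
move=> acc k; elim/ltn_ind: k => k IHk; apply: Ycl => e e0.
(* The error of this quotient is at most [K * normc t]; the radius [e / (K + 1)] used next also
   covers [K = 0]. *)
pose K := D * M ^+ k.+1; have K0 : 0 <= K by rewrite mulr_ge0 ?exprn_ge0.
have K1 : 0 < K + 1 by rewrite ltr_wpDl.
have [t [y [t0 te Yy exp_y]]] := acc (e / (K + 1)) (divr_gt0 e0 K1).
pose s := \sum_(0 <= j < k) t ^+ j *: v j.
have tk0 : t ^+ k != 0 by rewrite expf_neq0.
exists (t ^- k *: (y - s)).
  have Ys : Y s by exact: Ysum.
  rewrite -[_ *: _]addr0; apply: (Ylin _ _ Y0).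
  by rewrite addrC -scaleN1r; exact: Ylin.
have -> : v k - t ^- k *: (y - s) =
    (- t ^- k) *: (y - \sum_(0 <= j < k.+1) t ^+ j *: v j).
  rewrite big_nat_recr //= -/s opprD addrA [in RHS]scalerBr scalerA mulNr mulVf //.
  by rewrite !scaleNr scale1r opprK [RHS]addrC.
rewrite NZ normcNE normcV normcX.
have nt0 : 0 < normc t ^+ k by rewrite exprn_gt0 // normc_gt0.
rewrite mulrC ltr_pdivrMr //; apply: le_lt_trans (exp_y k.+1) _.
rewrite exprMn mulrA -/K exprS mulrA ltr_pM2r //.
move: te; rewrite ltr_pdivlMr //; apply: le_lt_trans.
by rewrite mulrC ler_wpM2l ?normc_nneg // lerDl.
Qed.

(** The partial sums lie in [Y], and the remainder [D * (M * normc t) ^+ n] tends to 0. *)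
Lemma expansion_sum t y : (forall k, Y (v k)) -> M * normc t < 1 ->
  expansion t y -> Y y.
Proof.
move=> Yv t1 exp_y; apply: Ycl => e e0.
have q0 : 0 <= M * normc t by rewrite mulr_ge0 ?normc_nneg.
have : (fun n => D * (M * normc t) ^+ n) @ \oo --> D * 0.
  by apply: cvgMr; apply: cvg_expr; rewrite ger0_norm.
rewrite mulr0 => /cvgrPdist_lt /(_ _ e0)[n _ /(_ n (leqnn n)) /= lt_e].
exists (\sum_(0 <= k < n) t ^+ k *: v k); first by apply: Ysum => k _; exact: Yv.
apply: le_lt_trans (exp_y n) _; apply: le_lt_trans lt_e.
by rewrite sub0r normrN ler_norm.
Qed.

End Taylor.

(** * An element is determined by its values on the disk *)

Section FvalInjective.
Variables (R : realType) (nu : R).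
Implicit Types (f g : dirichlet_space nu) (z : R[i]).

Lemma fval_eq0 f : (forall z, normc z < 1 -> fval f z = 0) -> f = 0.
Proof.
move=> f0; have half01 : 0 <= (2^-1 : R) < 1 by lra.
have [C leC] := dcoef_geo_le f half01.
have C0 : 0 <= C by apply: le_trans (leC 0); rewrite mulr_ge0 ?normc_nneg ?exprn_ge0.
have coef_le k : normc (f k) <= C * 2 ^+ k.
  by have := leC k; rewrite exprVn ler_pdivrMr ?exprn_gt0.
apply: dirichlet_ext => k; rewrite dcoef0.
(* The closed subspace is {0} in the complex line. As |f_k| <= C 2^k, the remainder at |t| <= 1/4 is
   at most 2 C (2 |t|)^n. *)
apply: (@expansion_coef _ R[i]^o (@normc R) (@normcM R)
  (fun x => x = 0) erefl _ _ f (2 * C) 2) => //.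
- by move=> c u v -> ->; rewrite scaler0 addr0.
- move=> u small; apply: normc_small0 => e e0.
  by have [_ -> ] := small e e0; rewrite subr0.
- by rewrite mulr_ge0.
move=> e e0; pose d := Num.min (4^-1) (e / 2); exists d%:C, 0.
have d0 : 0 < d by rewrite lt_min divr_gt0 // invr_gt0 ltr0n.
have d4 : d <= 4^-1 by rewrite ge_min lexx.
have nd : normc d%:C = d by rewrite normc_real gtr0_norm.
have de : d < e by rewrite /d gt_min; apply/orP; right; lra.
split => //; first by rewrite -normc_gt0 nd.
  by rewrite nd.
(* The value at [d] is 0, so a partial sum up to some large [m] is below [s]; only the terms from
   [n] to [m] need a geometric bound. *)
move=> n; rewrite nd sub0r normcNE; apply/ler_addgt0Pr => s s0.
have d1 : normc d%:C < 1 by rewrite nd; lra.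
have [N uN] := fval_tends f d1 s0; pose m := maxn N n.
have := uN m (leq_maxl _ _); rewrite f0 // subr0 => lt_s.
rewrite addrC -lerBlDr; apply: le_trans (ltW lt_s).
rewrite lerBlDl; set S := \sum_(0 <= k < n) _.
have -> : S = \sum_(0 <= k < m) f k * d%:C ^+ k - \sum_(n <= k < m) f k * d%:C ^+ k.
  rewrite (@big_cat_nat _ _ _ n 0 m) //= ?leq_maxr // addrK.
  by apply: eq_bigr => j _; rewrite mulrC.
apply: le_trans (normcB _ _) _; rewrite addrC lerD2r.
apply: le_trans (normc_sum _ _ _) _.
apply: le_trans (_ : \sum_(n <= k < m) C * (2 * d) ^+ k <= _).
  apply: ler_sum => j _; rewrite normcM normcX nd exprMn mulrA.
  by rewrite ler_wpM2r ?exprn_ge0 // ltW.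
rewrite -mulr_sumr [2 * C]mulrC -mulrA ler_wpM2l //.
have d01 : 0 <= 2 * d < 1 by lra.
apply: le_trans (sum_geo_le _ _ d01) _; rewrite mulrC ler_wpM2r ?exprn_ge0 //.
  by lra.
by rewrite invf_ple ?posrE; lra.
Qed.

Lemma fval_inj f g : (forall z, normc z < 1 -> fval f z = fval g z) -> f = g.
Proof.
move=> fg; apply/eqP; rewrite -subr_eq0; apply/eqP/fval_eq0 => z z1.
by rewrite fvalB // fg // subrr.
Qed.

Lemma geo_dnorm_le (y : R) : 0 <= y < 1 -> exists2 K, 0 <= K &
  forall f c, (forall j, normc (f j) <= c * y ^+ j) -> dnorm f <= c * K.
Proof.
move=> y01; have [K K0 KP] := geo_dirichlet nu y01; exists K => // f c lef.
have c0 : 0 <= c by have := lef 0; rewrite mulr1; apply: le_trans; exact: normc_nneg.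
have [g gf] := KP _ _ c0 lef.
by have -> : g = f by exact: dirichlet_ext.
Qed.

End FvalInjective.

(** * The functions (1 - b z) / (1 - x z) and z / (1 - x z) *)

Section Mob.
Variables (R : realType) (nu : R).
Implicit Types (f g : dirichlet_space nu) (b x z c : R[i]).

(* Taylor coefficients of z |-> (1 - b z) / (1 - x z). *)
Definition mob b x (j : nat) : R[i] := if j is k.+1 then (x - b) * x ^+ k else 1.

(* Taylor coefficients of z |-> z / (1 - x z). *)
Definition zgeo x (j : nat) : R[i] := if j is k.+1 then x ^+ k else 0.

Lemma zgeo_le x (y : R) : normc x <= y -> 0 < y ->
  forall j, normc (zgeo x j) <= y^-1 * y ^+ j.
Proof.
move=> xy y0 [|k]; rewrite /zgeo; first by rewrite normc0 mulr_ge0 ?exprn_ge0 ?invr_ge0 ?ltW.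
rewrite exprS mulKf ?gt_eqF // normcX.
by apply: lerXn2r; rewrite ?nnegrE ?normc_nneg // ltW.
Qed.

Lemma zgeo_dirichlet x : normc x < 1 ->
  exists f, forall j, f j = zgeo x j.
Proof.
(* The maximum with 1/2 keeps [y] positive even for [x = 0], as the bound of [zgeo_le] divides by
   [y]. *)
move=> x1; pose y := Num.max (normc x) (2^-1).
have y0 : 0 < y by rewrite lt_max invr_gt0 ltr0n orbT.
have y01 : 0 <= y < 1 by rewrite ltW //= gt_max x1; lra.
have [K _ KP] := geo_dirichlet nu y01.
have yV0 : 0 <= y^-1 by rewrite invr_ge0 ltW.
have [f fE _] := KP (zgeo x) _ yV0 (zgeo_le (ltac:(by rewrite le_max lexx) : normc x <= y) y0).
by exists f.
Qed.

Lemma const_dirichlet : exists f : dirichlet_space nu, forall j, f j = (j == 0%N)%:R.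
Proof.
have h01 : 0 <= (2^-1 : R) < 1 by lra.
have [K _ KP] := geo_dirichlet nu h01.
have [|f fE _] := KP (fun j => (j == 0%N)%:R) 1 ler01; last by exists f.
move=> j; rewrite normc_nat mul1r; case: j => [|j]; first by rewrite expr0.
by rewrite exprn_ge0 ?invr_ge0.
Qed.

(** (1 - b z) / (1 - x z) = 1 + (x - b) z / (1 - x z). *)
Lemma mob_dirichlet b x : normc x < 1 -> exists f, forall j, f j = mob b x j.
Proof.
move=> x1; have [g gE] := zgeo_dirichlet x1; have [e eE] := const_dirichlet.
exists (e + (x - b) *: g) => -[|k]; rewrite dcoefD dcoefZ gE eE /=.
  by rewrite mulr0 addr0.
by rewrite add0r.
Qed.

(** Multiplication by 1 - x z telescopes the partial sum; the last term is the error that vanishes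
    in [fval_mob]. *)
Lemma mob_sum b x z n :
  (1 - x * z) * \sum_(0 <= j < n.+1) mob b x j * z ^+ j =
  1 - b * z - (x - b) * x ^+ n * z ^+ n.+1.
Proof.
elim: n => [|n IHn]; first by rewrite big_nat1 /=; ring.
by rewrite big_nat_recr //= mulrDr IHn !exprS; ring.
Qed.

Lemma normc_geo_small z (C e : R) : normc z < 1 -> 0 < e ->
  exists N, forall n, (N <= n)%N -> C * normc z ^+ n < e.
Proof.
move=> z1 e0.
have : (fun n => C * normc z ^+ n) @ \oo --> C * 0.
  by apply: cvgMr; apply: cvg_expr; rewrite ger0_norm ?normc_nneg.
rewrite mulr0 => /cvgrPdist_lt /(_ _ e0)[N _ uN]; exists N => n Nn.
by have := uN n Nn; rewrite /= sub0r normrN; apply: le_lt_trans; exact: ler_norm.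
Qed.

Lemma one_sub_neq0 x z : normc x < 1 -> normc z <= 1 -> 1 - x * z != 0.
Proof.
move=> x1 z1; rewrite subr_eq0; apply/eqP => /(congr1 (@normc R)).
rewrite normc1 normcM => h; have := normc_nneg x; have := normc_nneg z; nra.
Qed.

Lemma fval_mob f c b x z : (forall j, f j = c * mob b x j) ->
  normc x < 1 -> normc z < 1 -> fval f z = c * ((1 - b * z) / (1 - x * z)).
Proof.
move=> fE x1 z1; have d0 := one_sub_neq0 x1 (ltW z1).
apply: fval_eq => e e0.
pose C := normc (c * (x - b) / (1 - x * z)).
have [N uN] := normc_geo_small C z1 e0; exists N.+1 => -[//|n] Nn.
apply: le_lt_trans (uN n.+1 (leqW Nn)).
have -> : \sum_(0 <= k < n.+1) f k * z ^+ k =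
    c * ((1 - b * z - (x - b) * x ^+ n * z ^+ n.+1) / (1 - x * z)).
  rewrite -mob_sum mulrC [_ * (\sum_(_ <= _ < _) _)]mulrC mulfK // mulrC mulr_sumr.
  by apply: eq_bigr => j _; rewrite fE mulrA.
rewrite [X in normc X](_ : _ = - (c * (x - b) / (1 - x * z)) * x ^+ n * z ^+ n.+1).
  rewrite 2!normcM normcNE -/C !normcX mulrAC ler_piMr //.
    by rewrite mulr_ge0 ?exprn_ge0 ?normc_nneg.
  by rewrite exprn_ile1 ?normc_nneg // ltW.
by field.
Qed.

End Mob.

(** * Composition with phi as a relation and as an operator *)

Section CompOp.
Variables (R : realType) (nu : R) (phi : sphere R -> sphere R).
Implicit Types (f g : dirichlet_space nu).

(** In relational form, explicit pairs can be combined linearly; each pair then determines a value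
    of [comp_op] through [comp_op_eq]. *)
Definition is_comp f g := forall z w : R[i],
  normc z < 1 -> phi (Some z) = Some w -> fval g z = fval f w.

Hypothesis phi_disk : forall z, normc z < 1 ->
  exists2 w, normc w < 1 & phi (Some z) = Some w.

(** The element chosen by [xget] has the same values on the disk as [g], hence equals it by
    [fval_inj]. *)
Lemma comp_op_eq f g : is_comp f g -> comp_op phi nu f = g.
Proof.
move=> fg; rewrite /comp_op; case: xgetP => [h _ fh|/(_ g)[]]; last first.
  by move=> z w; rewrite normc_lt1; exact: fg.
apply: fval_inj => z z1; have [w w1 zw] := phi_disk z1.
have nz1 := z1; rewrite -normc_lt1 in nz1.
by rewrite (fh z w nz1 zw) (fg z w z1 zw).
Qed.

(** The second case is the default value of [xget]; it is treated separately in [iter_comp_op]. *)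
Lemma comp_op_or f : is_comp f (comp_op phi nu f) \/ comp_op phi nu f = 0.
Proof.
rewrite /comp_op; case: xgetP => [h _ fh|_]; [left|by right].
by move=> z w z1; apply: fh; rewrite normc_lt1.
Qed.

Lemma is_compD f f' g g' : is_comp f g -> is_comp f' g' -> is_comp (f + f') (g + g').
Proof.
move=> fg fg' z w z1 zw; have [w' w'1] := phi_disk z1; rewrite zw => -[ww'].
rewrite -ww' in w'1.
by rewrite (fvalD g g' z1) (fvalD f f' w'1) (fg z w z1 zw) (fg' z w z1 zw).
Qed.

Lemma is_compZ c f g : is_comp f g -> is_comp (c *: f) (c *: g).
Proof.
move=> fg z w z1 zw; have [w' w'1] := phi_disk z1; rewrite zw => -[ww'].
rewrite -ww' in w'1.
by rewrite (fvalZ c g z1) (fvalZ c f w'1) (fg z w z1 zw).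
Qed.

Lemma is_compB f f' g g' : is_comp f g -> is_comp f' g' -> is_comp (f - f') (g - g').
Proof.
move=> fg fg' z w z1 zw; have [w' w'1] := phi_disk z1; rewrite zw => -[ww'].
rewrite -ww' in w'1.
by rewrite (fvalB g g' z1) (fvalB f f' w'1) (fg z w z1 zw) (fg' z w z1 zw).
Qed.

Lemma is_comp0 : is_comp 0 0.
Proof.
move=> z w z1 zw; have [w' w'1] := phi_disk z1; rewrite zw => -[ww'].
rewrite -ww' in w'1.
by rewrite (fval0 nu z1) (fval0 nu w'1).
Qed.

Lemma comp_op0 : comp_op phi nu 0 = 0.
Proof. exact: comp_op_eq is_comp0. Qed.

End CompOp.

(** * Density *)

Section ZgeoExpansion.
Variables (R : realType) (nu : R).
Implicit Types (f g : dirichlet_space nu) (x h : R[i]).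

(** The binomial coefficients vanish for k > m. The free upper bound allows one range to serve for a
    fixed truncation and for the full expansion. *)
Lemma exprDn_nat (T : comNzRingType) (x y : T) m p : (m < p)%N ->
  (x + y) ^+ m = \sum_(0 <= k < p) 'C(m, k)%:R * x ^+ (m - k) * y ^+ k.
Proof.
move=> mp; rewrite (@big_cat_nat _ _ _ m.+1) //= [X in _ = _ + X](_ : _ = 0) ?addr0; last first.
  rewrite big_nat_cond big1 // => k /andP[/andP[mk _] _].
  by rewrite bin_small // !mul0r.
rewrite exprDn big_mkord; apply: eq_bigr => k _.
by rewrite -mulrA -[in LHS]mulr_natl.
Qed.

(* The k-th Taylor coefficient of x |-> zgeo x at [x]. *)
Definition dzgeo x (k j : nat) : R[i] :=
  if j is m.+1 then 'C(m, k)%:R * x ^+ (m - k) else 0.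

(** The left side is one term of the binomial expansion of (|x| + d)^m. *)
Lemma dzgeo_le x (d : R) k m : 0 < d ->
  normc (dzgeo x k m.+1) * d ^+ k <= (normc x + d) ^+ m.
Proof.
move=> d0; have [km|mk] := leqP k m; last first.
  by rewrite /dzgeo bin_small // mul0r normc0 mul0r exprn_ge0 // addr_ge0 ?normc_nneg ?ltW.
rewrite (exprDn_nat _ _ (leqnn m.+1)) (bigD1_seq k) ?mem_index_iota ?iota_uniq //=.
rewrite /dzgeo normcM normc_nat normcX lerDl; apply: sumr_ge0 => i _.
by rewrite !mulr_ge0 ?exprn_ge0 ?normc_nneg // ltW.
Qed.

(** For k >= n, |h|^k <= (|h| / d)^n d^k; the remaining sum is part of the binomial expansion of
    (|x| + d)^m. *)
Lemma dzgeo_remainder x h (d : R) n m : 0 < d -> normc h <= d ->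
  normc (zgeo (x + h) m.+1 - \sum_(0 <= k < n) h ^+ k * dzgeo x k m.+1) <=
  (normc h / d) ^+ n * (normc x + d) ^+ m.
Proof.
move=> d0 hd; pose p := maxn n m.+1.
have q01 : 0 <= normc h / d <= 1.
  by rewrite ler_pdivrMr // mul1r hd divr_ge0 ?normc_nneg ?(ltW d0).
have /andP[q0 q1] := q01.
rewrite /zgeo (exprDn_nat _ _ (leq_maxr n m.+1)) -/p.
rewrite (@big_cat_nat _ _ _ n 0 p) //= ?leq_maxl //.
rewrite addrAC (_ : _ - _ = 0) ?add0r; last first.
  by apply/eqP; rewrite subr_eq0; apply/eqP/eq_bigr => k _; rewrite mulrC.
apply: le_trans (normc_sum _ _ _) _.
rewrite (exprDn_nat _ _ (leq_maxr n m.+1)) -/p (@big_cat_nat _ _ _ n 0 p) //= ?leq_maxl //.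
rewrite mulrDr ler_wpDl //.
  by rewrite mulr_ge0 ?exprn_ge0 // sumr_ge0 // => i _; rewrite !mulr_ge0 ?exprn_ge0 ?normc_nneg ?(ltW d0).
rewrite mulr_sumr big_nat_cond [leRHS]big_nat_cond.
apply: ler_sum => k /andP[/andP[nk _] _].
rewrite !normcM normc_nat !normcX mulrCA; apply: ler_wpM2l.
  by rewrite mulr_ge0 ?exprn_ge0 ?normc_nneg.
rewrite -[normc h in leLHS](divfK (lt0r_neq0 d0)) exprMn.
by rewrite ler_wpM2r ?exprn_ge0 ?(ltW d0) // ler_wiXn2l.
Qed.

Lemma dzgeo_dirichlet x : normc x < 1 ->
  exists v : nat -> dirichlet_space nu, forall k j, v k j = dzgeo x k j.
Proof.
move=> x1; pose d := (1 - normc x) / 2; have d0 : 0 < d by rewrite /d; lra.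
pose y := normc x + d; have y0 : 0 < y by rewrite ltr_wpDl ?normc_nneg.
have y01 : 0 <= y < 1 by rewrite ltW //= /y /d; lra.
have [K _ KP] := geo_dirichlet nu y01.
suff : forall k, exists f : dirichlet_space nu, forall j, f j = dzgeo x k j.
  by move=> /choice[v vE]; exists v.
move=> k; have [||f fE _] := KP (dzgeo x k) ((d ^+ k * y)^-1); last by exists f.
  by rewrite invr_ge0 mulr_ge0 ?exprn_ge0 // ltW.
move=> [|m]; first by rewrite /dzgeo normc0 mulr_ge0 ?exprn_ge0 ?invr_ge0 ?mulr_ge0 ?exprn_ge0 // ltW.
rewrite exprS invfM -mulrA mulKf ?gt_eqF //.
by rewrite mulrC ler_pdivlMr ?exprn_gt0 // dzgeo_le.
Qed.

(** The coefficientwise remainder decays at the rate |x| + d < 1, so one constant bounds its norm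
    for all truncations. *)
Lemma zgeo_expansion x (d : R) (v : nat -> dirichlet_space nu) :
  0 < d -> normc x + d < 1 -> (forall k j, v k j = dzgeo x k j) ->
  exists2 D, 0 <= D & forall h f, normc h <= d -> (forall j, f j = zgeo (x + h) j) ->
    expansion (@dnorm R nu) v D d^-1 h f.
Proof.
move=> d0 xd1 vE; pose y := normc x + d.
have y0 : 0 < y by rewrite ltr_wpDl ?normc_nneg.
have y01 : 0 <= y < 1 by rewrite ltW.
have [K K0 KP] := geo_dnorm_le nu y01; exists (y^-1 * K).
  by rewrite mulr_ge0 // invr_ge0 ltW.
move=> h f hd fE n; rewrite mulrAC; apply: KP => j.
rewrite dcoefB dcoef_sum fE.
rewrite (eq_bigr (fun k => h ^+ k * dzgeo x k j)); last by move=> k _; rewrite -vE.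
case: j => [|m].
  rewrite big1 => [|k _]; last by rewrite mulr0.
  rewrite subrr normc0 !mulr_ge0 ?exprn_ge0 ?mulr_ge0 ?invr_ge0 ?normc_nneg //; exact: ltW.
rewrite exprS mulrACA mulVf ?gt_eqF // mul1r [d^-1 * _]mulrC.
exact: dzgeo_remainder.
Qed.

End ZgeoExpansion.

(** * From parameters accumulating at b to the whole space *)

Section Density.
Variables (R : realType) (nu : R) (Y : dirichlet_space nu -> Prop).
Hypotheses (Y0 : Y 0) (Ylin : forall c f g, Y f -> Y g -> Y (c *: f + g)).
Hypothesis Ycl : forall f, (forall e, 0 < e -> exists2 g, Y g & dnorm (f - g) < e) -> Y f.
Implicit Types (f g : dirichlet_space nu) (x b : R[i]).

(** The condition y != x makes the increment y - x invertible, as the extraction of Taylor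
    coefficients requires. *)
Definition zgeo_cluster x := forall e : R, 0 < e -> exists y f,
  [/\ y != x, normc (y - x) < e, Y f & forall j, f j = zgeo y j].

Lemma zgeo_cluster_coef x (v : nat -> dirichlet_space nu) : normc x < 1 -> zgeo_cluster x ->
  (forall k j, v k j = dzgeo x k j) -> forall k, Y (v k).
Proof.
move=> x1 acc vE; pose d := (1 - normc x) / 2; have d0 : 0 < d by rewrite /d; lra.
have xd1 : normc x + d < 1 by rewrite /d; lra.
have [D D0 DP] := zgeo_expansion d0 xd1 vE.
apply: (expansion_coef (@Defs.dnormZ R nu) Y0 Ylin Ycl D0 (ltW (ltac:(by rewrite invr_gt0) : 0 < d^-1))).
move=> e e0; have [|y [f [yx yxe Yf fE]]] := acc (Num.min e d).
  by rewrite lt_min e0.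
move: yxe; rewrite lt_min => /andP[yxe yxd].
exists (y - x), f; split => //; first by rewrite subr_eq0.
by apply: DP; [exact: ltW|rewrite addrC subrK].
Qed.

Lemma zgeo_cluster_ball x f y : normc x < 1 -> zgeo_cluster x ->
  normc (y - x) < 1 - normc x -> (forall j, f j = zgeo y j) -> Y f.
Proof.
move=> x1 acc yx fE; have [v vE] := dzgeo_dirichlet nu x1.
(* Midway between |y - x| and 1 - |x|: the series about [x] then converges at [y], and |x| + d <
   1. *)
pose d := (1 - normc x + normc (y - x)) / 2.
have d0 : 0 < d by rewrite /d; have := normc_nneg (y - x); lra.
have xd1 : normc x + d < 1 by rewrite /d; lra.
have yxd : normc (y - x) < d by rewrite /d; lra.
have [D D0 DP] := zgeo_expansion d0 xd1 vE.
apply: (@expansion_sum R _ (@dnorm R nu) Y Y0 Ylin Ycl v D d^-1 _ (y - x) f).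
- by rewrite invr_ge0 ltW.
- exact: (zgeo_cluster_coef x1 acc vE).
- by rewrite mulrC ltr_pdivrMr // mul1r.
- by apply: DP; [exact: ltW|rewrite addrC subrK].
Qed.

Lemma zgeo_cluster_shift x y : normc x < 1 -> zgeo_cluster x ->
  normc (y - x) < 1 - normc x -> zgeo_cluster y.
Proof.
move=> x1 acc yx e e0.
(* The nearby parameter is [y + s], with [s] small enough to stay in the ball of
   [zgeo_cluster_ball]. *)
pose s := Num.min (e / 2) ((1 - normc x - normc (y - x)) / 2).
have s0 : 0 < s by rewrite lt_min; apply/andP; split; lra.
have ns : normc s%:C = s by rewrite normc_real gtr0_norm.
have se : s <= e / 2 by rewrite ge_min lexx.
have sx : s <= (1 - normc x - normc (y - x)) / 2 by rewrite ge_min lexx orbT.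
have zx : normc (y + s%:C - x) < 1 - normc x.
  by rewrite addrAC; apply: le_lt_trans (normcD _ _) _; rewrite ns; lra.
have z1 : normc (y + s%:C) < 1.
  have := normcD (y + s%:C - x) x; rewrite subrK; lra.
have [f fE] := zgeo_dirichlet nu z1; exists (y + s%:C), f.
have sE : y + s%:C - y = s%:C by rewrite addrAC subrr add0r.
split => //.
- by rewrite -subr_eq0 sE -normc_gt0 ns.
- by rewrite sE ns; lra.
- exact: zgeo_cluster_ball zx fE.
Qed.

(** The segment from b to 0 is cut into N steps of length at most 1/N < 1 - |b|. Each step stays in
    the ball of radius 1 - |p_i| around its starting point p_i. *)
Lemma zgeo_cluster_0 b : normc b < 1 -> zgeo_cluster b -> zgeo_cluster 0.
Proof.
move=> b1 acc; pose N := (Num.bound ((1 - normc b)^-1)).+1.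
have N0 : 0 < N%:R :> R by rewrite ltr0n.
have bN : N%:R^-1 < 1 - normc b.
  rewrite invf_plt ?posrE ?subr_gt0 //.
  apply: lt_trans (_ : (Num.bound ((1 - normc b)^-1))%:R < _); last by rewrite ltr_nat.
  by apply: archi_boundP; rewrite invr_ge0 subr_ge0 ltW.
pose p i : R[i] := (1 - i%:R / N%:R)%:C * b.
have nb0 := normc_nneg b.
have pb i : (i <= N)%N -> normc (p i) <= normc b.
  move=> iN; rewrite normcM normc_real ler_piMl // ger0_norm.
    by rewrite lerBlDr lerDl divr_ge0.
  by rewrite subr_ge0 ler_pdivrMr // mul1r ler_nat.
have acc_p i : (i <= N)%N -> zgeo_cluster (p i).
  elim: i => [_|i IHi iN]; first by rewrite /p mul0r subr0 mul1r.
  have pi := pb i (ltnW iN).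
  apply: zgeo_cluster_shift (IHi (ltnW iN)) _; first exact: le_lt_trans pi b1.
  rewrite -mulrBl -rmorphB normcM normc_real.
  have -> : 1 - i.+1%:R / N%:R - (1 - i%:R / N%:R) = - N%:R^-1 :> R.
    by rewrite -natr1; field; rewrite gt_eqF.
  rewrite normrN gtr0_norm ?invr_gt0 //.
  apply: le_lt_trans (_ : _ <= N%:R^-1) _; last by apply: (lt_le_trans bN); lra.
  by rewrite ler_piMr ?invr_ge0 ?ltW.
by have := acc_p N (leqnn N); rewrite /p divff ?gt_eqF // subrr mul0r.
Qed.

(** At the center 0 the Taylor coefficients in x are the monomials of positive degree. With the
    constant [e] they give all partial sums of [f], which converge to [f] in norm. *)
Lemma zgeo_cluster_dense b e : normc b < 1 -> zgeo_cluster b ->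
  Y e -> (forall j, e j = (j == 0%N)%:R) -> forall f, Y f.
Proof.
move=> b1 acc Ye eE f; have acc0 := zgeo_cluster_0 b1 acc.
have n01 : normc (0 : R[i]) < 1 by rewrite normc0.
have [v vE] := dzgeo_dirichlet nu n01.
have Yv := zgeo_cluster_coef n01 acc0 vE.
(* [v m] is the monomial of degree m + 1, hence the shift. *)
pose u k := if k is m.+1 then v m else e.
have Yu k : Y (u k) by case: k => [|k]; [exact: Ye|exact: Yv].
have uE k j : u k j = (j == k)%:R.
  case: k => [|k] /=; first exact: eE.
  rewrite vE; case: j => [|m] //=; rewrite eqSS expr0n subn_eq0.
  by case: ltngtP => [mk|km|->]; rewrite ?binn ?mulr1 ?mulr0 // bin_small // mul0r.
have Ys n : Y (\sum_(0 <= k < n) f k *: u k).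
  elim: n => [|n IHn]; first by rewrite big_geq.
  by rewrite big_nat_recr //= addrC; apply: Ylin.
apply: Ycl => s s0.
have tail_cvg : cvgn (series (dterm nu f)) by exact: dcoef_is_cvg.
have s20 : 0 < (s / 2) ^+ 2 by rewrite exprn_gt0 // divr_gt0.
have /cvgrPdist_lt /(_ _ s20)[n _ /(_ n (leqnn n)) /= lt_s] := tail_cvg.
exists (\sum_(0 <= k < n) f k *: u k); first exact: Ys.
apply: le_lt_trans (_ : _ <= s / 2) _; last by lra.
have sumE j : (f - \sum_(0 <= k < n) f k *: u k) j = if (j < n)%N then 0 else f j.
  rewrite dcoefB dcoef_sum.
  rewrite (eq_bigr (fun k => f k * (j == k)%:R)); last by move=> k _; rewrite -uE.
  case: ltnP => jn.
    rewrite (bigD1_seq j) ?mem_index_iota ?iota_uniq //= eqxx mulr1.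
    by rewrite big1 ?addr0 ?subrr // => i ij; rewrite eq_sym (negbTE ij) mulr0.
  rewrite big_nat_cond big1 ?subr0 // => i /andP[/andP[_ i_n] _].
  by rewrite gtn_eqF ?mulr0 // (leq_trans i_n).
move: (f - _) sumE => g gE.
apply: dnorm_le; first by rewrite divr_ge0 // ltW.
move=> m; apply: le_trans (ltW lt_s); apply: le_trans (ler_norm _).
rewrite lerBrDr.
have [mn|nm] := leqP m n.
  rewrite big_nat_cond big1 => [|i /andP[/andP[_ im] _]]; last first.
    by rewrite /dterm gE (leq_trans im mn) normc0 expr0n mul0r.
  rewrite add0r; apply: (@nondecreasing_cvgn_le _ (series (dterm nu f))) => //.
  exact: series_dterm_homo.
apply: le_trans (_ : series (dterm nu f) m <= _); last first.
  by apply: nondecreasing_cvgn_le => //; exact: series_dterm_homo.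
rewrite /series /= !(@big_cat_nat _ _ _ n 0 m) ?(ltnW nm) //=.
rewrite big_nat_cond big1 ?add0r => [|i /andP[/andP[_ im] _]]; last first.
  by rewrite /dterm gE im normc0 expr0n mul0r.
rewrite [leRHS]addrC lerD2r big_nat_cond [leRHS]big_nat_cond.
by apply: ler_sum => i /andP[/andP[ni _] _]; rewrite /dterm gE ltnNge ni.
Qed.

End Density.

(** * The linear fractional map *)

Section HalfPlane.
Variables (R : realType) (a b : R[i]).
Hypotheses (a1 : normc a = 1) (b1 : normc b <= 1).
Implicit Types z w V : R[i].

Definition wmap z : R[i] := (1 - a * z) / (1 - b * z).

(* [wmap] carries the unit disk to the region where [wgap] is positive, a disk
   or half-plane with 0 on its boundary. *)
Definition wgap V : R := normc (a - b * V) ^+ 2 - normc (1 - V) ^+ 2.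

(** As |a| = 1, the gap is a real-linear form in V minus (1 - |b|^2) |V|^2, and only the quadratic
    part fails to scale by s. *)
Lemma wgap_scaleE V (s : R) :
  wgap (s%:C * V) - s * wgap V = s * (1 - s) * (1 - normc b ^+ 2) * normc V ^+ 2.
Proof.
have := sqr_normcE a; rewrite a1 expr1n /wgap !sqr_normcE.
case: (a) => x y; case: (b) => u v; case: V => p q /= e1.
have {}e1 : x ^+ 2 = 1 - y ^+ 2 by rewrite e1; ring.
ring: e1.
Qed.

Lemma wgap_scale V (s : R) : 0 <= s <= 1 -> s * wgap V <= wgap (s%:C * V).
Proof.
move=> /andP[s0 s1]; rewrite -subr_ge0 wgap_scaleE.
rewrite mulr_ge0 ?sqr_ge0 // mulr_ge0 ?mulr_ge0 ?subr_ge0 //.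
by rewrite expr_le1 ?normc_nneg.
Qed.

Lemma wmap_den_neq0 z : normc z < 1 -> 1 - b * z != 0.
Proof. by move=> z1; rewrite mulrC one_sub_neq0. Qed.

(** Multiplying by 1 - b z turns a - b W into a - b and 1 - W into (a - b) z. The gap of W thus
    measures the distance of z to the unit circle. *)
Lemma wgap_wmap z : normc z < 1 ->
  normc (1 - b * z) ^+ 2 * wgap (wmap z) = normc (a - b) ^+ 2 * (1 - normc z ^+ 2).
Proof.
move=> z1; have d0 := wmap_den_neq0 z1.
rewrite /wgap mulrBr -!exprMn -!normcM !mulrBr mulr1.
have -> : (1 - b * z) * (b * wmap z) = b * (1 - a * z) by rewrite /wmap; field.
have -> : (1 - b * z) * wmap z = 1 - a * z by rewrite /wmap; field.
have -> : (1 - b * z) * a - b * (1 - a * z) = a - b by ring.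
have -> : 1 - b * z - (1 - a * z) = (a - b) * z by ring.
by rewrite normcM exprMn mulr1.
Qed.

Lemma wmapB z w : normc z < 1 -> normc w < 1 ->
  (wmap z - wmap w) * ((1 - b * z) * (1 - b * w)) = (b - a) * (z - w).
Proof.
move=> z1 w1; have d0 := wmap_den_neq0 z1; have d1 := wmap_den_neq0 w1.
by rewrite /wmap; field; rewrite d0 d1.
Qed.

Lemma wmap_inj z w : a != b -> normc z < 1 -> normc w < 1 -> wmap z = wmap w -> z = w.
Proof.
move=> ab z1 w1 zw; have := wmapB z1 w1; rewrite zw subrr mul0r => /esym/eqP.
by rewrite mulf_eq0 !subr_eq0 eq_sym (negbTE ab) => /eqP.
Qed.

(** The preimage is (1 - V) / (a - b V), and positivity of the gap says that its modulus is below
    1. *)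
Lemma wmap_surj V : 0 < wgap V -> exists2 z, normc z < 1 & wmap z = V.
Proof.
rewrite subr_gt0 => gap.
have den0 : a - b * V != 0.
  rewrite -normc_gt0 lt_def normc_nneg andbT; apply: contraTneq gap => ->.
  by rewrite expr0n -leNgt sqr_ge0.
have nden0 : 0 < normc (a - b * V) by rewrite normc_gt0.
have z1 : normc ((1 - V) / (a - b * V)) < 1.
  rewrite normcM normcV ltr_pdivrMr // mul1r.
  by rewrite -(@ltr_pXn2r _ 2) ?nnegrE ?normc_nneg.
exists ((1 - V) / (a - b * V)) => //.
have := wmap_den_neq0 z1; rewrite /wmap.
have -> : 1 - b * ((1 - V) / (a - b * V)) = (a - b) / (a - b * V) by field.
rewrite mulf_eq0 negb_or => /andP[ab0 _].
by field; rewrite den0 ab0.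
Qed.

End HalfPlane.

(** * Reduction of phi to multiplication by r in the coordinate W *)

Section NormalForm.
Variables (R : realType) (phi : sphere R -> sphere R).
Implicit Types (A B C D z w : R[i]).

Hypothesis phi_lf : linear_fractional phi.
Hypothesis phi_disk : forall z, normc z < 1 ->
  exists2 w, normc w < 1 & phi (Some z) = Some w.
Hypothesis phi_fix : forall z, normc z < 1 -> phi (Some z) <> Some z.
Hypothesis phi_naut : ~ disk_automorphism phi.

Definition normal_form (a b : R[i]) (r : R) := forall z w,
  normc z < 1 -> phi (Some z) = Some w -> wmap a b w = r%:C * wmap a b z.

Lemma pow_small (r e : R) : 0 <= r < 1 -> 0 < e -> exists n, r ^+ n < e.
Proof.
move=> /andP[r0 r1] e0; have : (fun n => r ^+ n) @ \oo --> (0 : R).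
  by apply: cvg_expr; rewrite ger0_norm.
move=> /cvgrPdist_lt /(_ _ e0)[n _ /(_ n (leqnn n)) /=].
by rewrite sub0r normrN ger0_norm ?exprn_ge0 //; exists n.
Qed.

(** Along the orbit of 0, W equals r^n, so 1 - |a| <= |1 - a w| <= 2 r^n for every n; this excludes
    |a| < 1. *)
Lemma normal_form_fixed a b r : 0 < r < 1 -> normc a <= 1 -> normc b <= 1 ->
  normal_form a b r -> normc a = 1.
Proof.
move=> /andP[r0 r1] a1 b1 nf; apply/eqP; rewrite eq_le a1 leNgt; apply/negP => lt_a.
have orbit n : exists2 w, normc w < 1 & wmap a b w = (r ^+ n)%:C.
  elim: n => [|n [w w1 wE]].
    by exists 0; rewrite ?normc0 // /wmap !mulr0 subr0 divr1.
  have [v v1 wv] := phi_disk w1; exists v => //.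
  by rewrite (nf w v w1 wv) wE exprS rmorphM.
have e0 : 0 < (1 - normc a) / 2 by rewrite divr_gt0 // subr_gt0.
have [n lt_n] := @pow_small r _ (ltac:(by rewrite ltW) : 0 <= r < 1) e0.
have [w w1 wE] := orbit n; have d0 := wmap_den_neq0 b1 w1.
have : normc (1 - a * w) <= (r ^+ n) * 2.
  have -> : 1 - a * w = (r ^+ n)%:C * (1 - b * w) by rewrite -wE divfK.
  rewrite normcM normc_real gtr0_norm ?exprn_gt0 // ler_pM2l ?exprn_gt0 //.
  apply: le_trans (normcB _ _) _; rewrite normc1 normcM.
  by have := normc_nneg b; have := normc_nneg w; nra.
have : 1 - normc a <= normc (1 - a * w).
  apply: le_trans (normcB_ge _ _); rewrite normc1 normcM.
  by have := normc_nneg a; have := normc_nneg w; nra.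
by move: lt_n; rewrite ltr_pdivlMr //; lra.
Qed.

(* With both fixed points on the circle, [phi] is a dilation of the half-plane
   [wgap > 0], hence onto. *)
Lemma normal_form_interior a b r : 0 < r < 1 -> normc a = 1 -> normc b <= 1 ->
  a != b -> normal_form a b r -> normc b < 1.
Proof.
move=> /andP[r0 r1] a1 b1 ab nf; rewrite lt_def b1 andbT; apply/eqP => b1'.
have rC : r%:C != 0 :> R[i] by rewrite -normc_eq0 normc_real normr_eq0 gt_eqF.
apply: phi_naut; split => //; split.
- move=> _ [z z1 <-]; move: z1; rewrite /= normc_lt1 => z1.
  by have [w w1 ->] := phi_disk z1; exists w; rewrite //= normc_lt1.
- move=> _ _ /set_mem[z z1 <-] /set_mem[v v1 <-]; move: z1 v1.
  rewrite /= !normc_lt1 => z1 v1; have [w w1 zw] := phi_disk z1.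
  rewrite zw => /esym vw; congr Some; apply: (wmap_inj b1 ab z1 v1).
  by apply: (mulfI rC); rewrite -(nf z w z1 zw) -(nf v w v1 vw).
move=> _ [w w1 <-]; move: w1; rewrite /= normc_lt1 => w1.
have gw : 0 < wgap a b (wmap a b w).
  rewrite -(@pmulr_rgt0 _ (normc (1 - b * w) ^+ 2)).
    rewrite wgap_wmap // mulr_gt0 ?exprn_gt0 ?normc_gt0 ?subr_eq0 //.
    by rewrite subr_gt0 expr_lt1 ?normc_nneg.
  by rewrite exprn_gt0 // normc_gt0 wmap_den_neq0.
(* The W-coordinate of the preimage of [w]; for |b| = 1 the gap scales exactly, so it stays
   positive. *)
pose V := r^-1%:C * wmap a b w.
have gV : 0 < wgap a b V.
  have := wgap_scaleE b a1 (wmap a b w) r^-1.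
  rewrite -b1' expr1n subrr mulr0 mul0r => /eqP; rewrite subr_eq0 => /eqP ->.
  by rewrite mulr_gt0 ?invr_gt0.
have [z z1 zV] := wmap_surj b1 gV; exists (Some z).
  by exists z; rewrite //= normc_lt1.
have [v v1 zv] := phi_disk z1; rewrite zv; congr Some.
apply: (wmap_inj b1 ab v1 w1); rewrite (nf z v z1 zv) zV /V mulrA -rmorphM.
by rewrite divff ?gt_eqF // mul1r.
Qed.

(** With a = -A/B and b = -C/D, W is (A z + B) / (C z + D) up to the factor D/B. Absence of zeros of
    A z + B and C z + D in the disk gives |a|, |b| <= 1. *)
Lemma normal_form_of_linear A B C D r : A * D - B * C != 0 -> 0 < r < 1 ->
  (forall z, normc z < 1 -> A * z + B != 0 /\ C * z + D != 0) ->
  (forall z w, normc z < 1 -> phi (Some z) = Some w ->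
    (A * w + B) * (C * z + D) = r%:C * (A * z + B) * (C * w + D)) ->
  exists a b, [/\ normc a = 1, normc b < 1 & normal_form a b r].
Proof.
move=> det0 r01 nz rel.
have n0 : normc (0 : R[i]) < 1 by rewrite normc0.
have [] := nz 0 n0; rewrite !mulr0 !add0r => B0 D0.
have le1 E F : F != 0 -> (forall z, normc z < 1 -> E * z + F != 0) -> normc (- E / F) <= 1.
  move=> F0 EF; rewrite leNgt; apply/negP => lt1.
  have E0 : E != 0 by apply: contraTneq lt1 => ->; rewrite oppr0 mul0r normc0 ltr10.
  have := EF (- F / E); rewrite mulrCA divff // mulr1 addNr eqxx => /(_ _)/negP.
  apply => //.
  have -> : - F / E = (- E / F)^-1 by field; rewrite F0 E0.
  by rewrite normcV invf_lt1 // (lt_trans ltr01).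
pose a := - A / B; pose b := - C / D.
have a1 : normc a <= 1 by apply: le1 => // z /nz[].
have b1 : normc b <= 1 by apply: le1 => // z /nz[].
have ab : a != b.
  apply: contraNneq det0 => ab; rewrite subr_eq0 -eqr_opp.
  by apply/eqP; move: ab; rewrite /a /b => /eqP; rewrite eqr_div // => /eqP; rewrite !mulNr [C * B]mulrC.
have nf : normal_form a b r.
  move=> z w z1 zw; have [w' w'1] := phi_disk z1; rewrite zw => -[ww'].
  rewrite -ww' in w'1.
  have [nz0 dz0] := nz z z1; have [nw0 dw0] := nz w w'1.
  have E : forall v, normc v < 1 -> wmap a b v = (D / B) * ((A * v + B) / (C * v + D)).
    move=> v v1; have [_ dv0] := nz v v1; rewrite /wmap /a /b.
    by field; rewrite B0 D0 dv0.
  rewrite (E z z1) (E w w'1) [RHS]mulrCA; congr (_ * _).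
  apply/eqP; rewrite mulrA eqr_div //; apply/eqP; exact: rel.
have a1' := normal_form_fixed r01 a1 b1 nf.
by exists a, b; split => //; exact: normal_form_interior r01 a1' b1 ab nf.
Qed.

(** The conjugating map sends the fixed points of phi to 0 and infinity, so it has neither zero nor
    pole in the disk. *)
Lemma hyperbolic_normal_form : hyperbolic phi ->
  exists a b r, [/\ normc a = 1, normc b < 1, 0 < r < 1 & normal_form a b r].
Proof.
move=> [_ _ _ [mu [mu0 mu1 [psi [A [B [C [D [det0 psiE]]]]] conj]]]].
have conjE p : mobius A B C D (phi p) = dilation mu%:C (mobius A B C D p).
  by rewrite -!psiE; exact: conj.
have zero_inj (E F z w : R[i]) : (E != 0) || (F != 0) -> E * z + F = 0 -> E * w + F = 0 -> z = w.
  move=> EF ez ew; have [E0|E0] := eqVneq E 0.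
    by move: EF ez; rewrite E0 eqxx mul0r add0r /= => /negP F0 /eqP.
  by apply: (mulfI E0); apply: (addIr F); rewrite ez ew.
have nz z : normc z < 1 -> A * z + B != 0 /\ C * z + D != 0.
  move=> z1; have [w w1 zw] := phi_disk z1.
  have := conjE (Some z); rewrite zw /= => conjz.
  have zNw : z <> w by move=> e; apply: (phi_fix z1); rewrite zw e.
  have CD : (C != 0) || (D != 0).
    by apply: contraNT det0; rewrite negb_or !negbK => /andP[/eqP-> /eqP->]; rewrite !mulr0 subrr.
  have AB : (A != 0) || (B != 0).
    by apply: contraNT det0; rewrite negb_or !negbK => /andP[/eqP-> /eqP->]; rewrite !mul0r subrr.
  have dz : C * z + D != 0.
    apply/eqP => dz0; apply: zNw; apply: (zero_inj _ _ _ _ CD dz0).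
    by move: conjz; rewrite dz0 eqxx; case: eqP.
  split => //; apply/eqP => nz0; apply: zNw; apply: (zero_inj _ _ _ _ AB nz0).
  move: conjz; rewrite (negbTE dz) nz0; case: eqP => //= dw [].
  rewrite mul0r mulr0 => /eqP; rewrite mulf_eq0 invr_eq0.
  by move/eqP: dw => /negbTE ->; rewrite orbF => /eqP.
have rel z w : normc z < 1 -> phi (Some z) = Some w ->
    (A * w + B) * (C * z + D) = mu%:C * (A * z + B) * (C * w + D).
  move=> z1 zw; have [w' w'1] := phi_disk z1; rewrite zw => -[ww'].
  rewrite -ww' in w'1; have [_ dz] := nz z z1; have [_ dw] := nz w w'1.
  have := conjE (Some z); rewrite zw /= (negbTE dz) (negbTE dw) => -[/eqP].
  by rewrite mulrA eqr_div // => /eqP.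
have muC : mu%:C != 0 :> R[i] by rewrite -normc_eq0 normc_real normr_eq0 gt_eqF.
have [mu_lt1|mu_ge1] := ltP mu 1.
  have mu01 : 0 < mu < 1 by rewrite mu0.
  by have [a [b [a1 b1 nf]]] := normal_form_of_linear det0 mu01 nz rel; exists a, b, mu.
(* For mu > 1, exchanging numerator and denominator of the conjugating map replaces mu by its
   inverse. *)
have mu01 : 0 < mu^-1 < 1.
  by rewrite invr_gt0 mu0 invf_lt1 // lt_def mu1.
have det0' : C * B - D * A != 0 by rewrite -oppr_eq0 opprB [D * A]mulrC [C * B]mulrC.
have nz' z : normc z < 1 -> C * z + D != 0 /\ A * z + B != 0 by move=> /nz[].
have [|a [b [a1 b1 nf]]] := normal_form_of_linear det0' mu01 nz'; last by exists a, b, mu^-1.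
have muV : mu%:C * mu^-1%:C = 1 :> R[i] by rewrite -rmorphM divff ?gt_eqF.
move=> z w z1 zw; apply: (mulfI muC).
have -> : mu%:C * (mu^-1%:C * (C * z + D) * (A * w + B)) =
    mu%:C * mu^-1%:C * ((A * w + B) * (C * z + D)) by ring.
by rewrite muV mul1r (rel z w z1 zw); ring.
Qed.

End NormalForm.

(** * Recurrence below the critical exponent *)

Section PowerSplit.
Variable R : realType.
Implicit Types (s d t : R).

(** Once j + 1 exceeds C = d^(-1/(1 - s)), (j + 1)^(1 - s) >= 1/d, so the linear term dominates;
    before that, (j + 1)^s <= j + 1 <= C. *)
Lemma powR_succn_split s d : s < 1 -> 0 < d ->
  exists2 C, 0 <= C & forall j, j.+1%:R `^ s <= d * j.+1%:R + C.
Proof.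
move=> s1 d0; pose C := d^-1 `^ (1 - s)^-1; have s0 : 0 < 1 - s by rewrite subr_gt0.
exists C => [|j]; first exact: powR_ge0.
have [jC|Cj] := leP j.+1%:R C.
  apply: le_trans (_ : j.+1%:R <= _); first by rewrite ler1_powR ?ler1n // ltW.
  by apply: le_trans jC _; rewrite lerDr mulr_ge0 // ltW.
apply: le_trans (_ : d * j.+1%:R <= _); last by rewrite lerDl powR_ge0.
have Cs : d^-1 <= j.+1%:R `^ (1 - s).
  have -> : d^-1 = C `^ (1 - s).
    by rewrite /C -powRrM mulVf ?lt0r_neq0 // powRr1 // invr_ge0 ltW.
  by apply: (ge0_ler_powR (ltW s0)); rewrite ?nnegrE ?powR_ge0 // ltW.
rewrite -[s](subKr 1) powRB ?pnatr_eq0 ?implybT // powRr1 // ler_pdivrMr ?powR_gt0 //.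
rewrite mulrAC; apply: le_trans (_ : d * d^-1 * j.+1%:R <= _).
  by rewrite divff ?mul1r // gt_eqF.
by rewrite ler_wpM2r // ler_wpM2l // ltW.
Qed.

(** (1 - t) times the sum is the geometric sum minus n t^n; the induction keeps this boundary
    term. *)
Lemma sum_succn_geo_le t n : 0 <= t < 1 ->
  \sum_(0 <= j < n) j.+1%:R * t ^+ j <= (1 - t) ^- 2.
Proof.
move=> /[dup] t01 /andP[t0 t1]; have d0 : 0 < 1 - t by rewrite subr_gt0.
suff le_n : (1 - t) * \sum_(0 <= j < n) j.+1%:R * t ^+ j <= \sum_(0 <= j < n) t ^+ j.
  rewrite -div1r exprS expr1 invfM mulrA ler_pdivlMr // mulrC.
  by apply: le_trans le_n _; apply: le_trans (sum_geo_le _ _ t01) _; rewrite expr0.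
elim: n => [|n IHn]; first by rewrite !big_geq // mulr0.
suff : (1 - t) * \sum_(0 <= j < n) j.+1%:R * t ^+ j + n%:R * t ^+ n <=
    \sum_(0 <= j < n) t ^+ j.
  rewrite !big_nat_recr //= mulrDr -natr1.
  have : 0 <= n%:R * t ^+ n.+1 + t ^+ n.+1 by rewrite addr_ge0 ?mulr_ge0 ?exprn_ge0.
  rewrite exprS; set S := \sum_(_ <= _ < _) _; set S' := \sum_(_ <= _ < _) _.
  move=> h1 h2; have -> : (1 - t) * ((n%:R + 1) * t ^+ n) =
    n%:R * t ^+ n + t ^+ n - (n%:R * (t * t ^+ n) + t * t ^+ n) by ring.
  lra.
elim: {IHn} n => [|n IHn]; first by rewrite !big_geq // mul0r mulr0 addr0.
rewrite !big_nat_recr //= -natr1 exprS mulrDr; move: IHn.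
set S := \sum_(_ <= _ < _) _; set S' := \sum_(_ <= _ < _) _ => IHn.
have -> : (1 - t) * S + (1 - t) * ((n%:R + 1) * t ^+ n) + (n%:R + 1) * (t * t ^+ n) =
  (1 - t) * S + n%:R * t ^+ n + t ^+ n by ring.
by rewrite lerD2r.
Qed.

End PowerSplit.

(** * The family 1 / (q + k W) and its limits for small and large q *)

Section Eigenfamily.
Variables (R : realType) (nu : R) (a b : R[i]).
Hypotheses (a1 : normc a = 1) (b1 : normc b < 1).
Implicit Types (f g : dirichlet_space nu) (z : R[i]) (q : R).

(** With this factor k a = a - b, and q + k W has no zero in the disk for any q > 0 (see
    [fam_pole_lt1]). *)
Let k : R[i] := 1 - b * a^*.
(** [fam_den] and [fam_pole] come from q + k W(z) = fam_den q (1 - fam_pole q z) / (1 - b z). *)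
Definition fam_den q : R[i] := q%:C + k.
Definition fam_pole q : R[i] := (q%:C * b + (a - b)) / fam_den q.

(* Taylor coefficients of z |-> 1 / (q + k W z), where W z = (1 - a z) / (1 - b z). *)
Definition fam q (j : nat) : R[i] := (fam_den q)^-1 * mob b (fam_pole q) j.

Lemma mulc_conj1 : a * a^* = 1.
Proof.
have := sqr_normcE a; rewrite a1 expr1n; case: (a) => x y /= e1.
by apply/eqP; rewrite eq_complex /=; apply/andP; split; apply/eqP; [rewrite e1; ring|ring].
Qed.

Lemma k_eq : k * a = a - b.
Proof. by rewrite mulrBl mul1r -mulrA [a^* * a]mulrC mulc_conj1 mulr1. Qed.

Lemma k_gt0 : 0 < normc k.
Proof.
have -> : normc k = normc (a - b) by rewrite -k_eq normcM a1 mulr1.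
by apply: lt_le_trans (normcB_ge _ _); rewrite a1 subr_gt0.
Qed.

Lemma k_le2 : normc k <= 2.
Proof.
have -> : normc k = normc (a - b) by rewrite -k_eq normcM a1 mulr1.
apply: le_trans (normcB _ _) _; rewrite a1. move: b1; lra.
Qed.

(** For q > 0 both terms on the right are nonnegative; the one linear in q bounds 1 - |fam_pole q|^2
    from below as q tends to 0. *)
Lemma fam_den_num q : normc (fam_den q) ^+ 2 - normc (q%:C * b + (a - b)) ^+ 2 =
  q ^+ 2 * (1 - normc b ^+ 2) + 2 * q * normc k ^+ 2.
Proof.
have := sqr_normcE a; rewrite a1 expr1n /fam_den /k !sqr_normcE.
case: (a) => x y; case: (b) => u v /= e1.
have {}e1 : x ^+ 2 = 1 - y ^+ 2 by rewrite e1; ring.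
ring: e1.
Qed.

Lemma fam_den_gt0 q : 0 < q -> 0 < normc (fam_den q).
Proof.
move=> q0; rewrite lt_def normc_nneg andbT; apply/eqP => d0.
have := fam_den_num q; rewrite d0 expr0n /=.
have : 0 < 2 * q * normc k ^+ 2 by rewrite !mulr_gt0 ?exprn_gt0 ?k_gt0.
have : 0 <= q ^+ 2 * (1 - normc b ^+ 2).
  by rewrite mulr_ge0 ?sqr_ge0 // subr_ge0 expr_le1 ?normc_nneg // ltW.
by have := sqr_ge0 (normc (q%:C * b + (a - b))); lra.
Qed.

Lemma fam_pole_gap q : 0 < q ->
  2 * q * normc k ^+ 2 / normc (fam_den q) ^+ 2 <= 1 - normc (fam_pole q) ^+ 2.
Proof.
move=> q0; have d0 := fam_den_gt0 q0.
rewrite /fam_pole normcM normcV exprMn exprVn ler_pdivrMr ?exprn_gt0 //.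
rewrite mulrBl mul1r divfK ?lt0r_neq0 ?exprn_gt0 // fam_den_num lerDr.
by rewrite mulr_ge0 ?sqr_ge0 // subr_ge0 expr_le1 ?normc_nneg // ltW.
Qed.

Lemma fam_pole_lt1 q : 0 < q -> normc (fam_pole q) < 1.
Proof.
move=> q0; rewrite -(@expr_lt1 _ 2) ?normc_nneg // -subr_gt0.
apply: lt_le_trans (fam_pole_gap q0).
by rewrite divr_gt0 ?exprn_gt0 ?fam_den_gt0 ?mulr_gt0 ?exprn_gt0 ?k_gt0.
Qed.

(** Shows that the parameters [fam_pole q] approach [b] as q grows, without reaching it. *)
Lemma fam_poleB q : 0 < q -> fam_pole q - b = a * k ^+ 2 / fam_den q.
Proof.
move=> q0; have := fam_den_gt0 q0; rewrite normc_gt0 => d0.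
apply: (mulIf d0); rewrite mulrBl /fam_pole !divfK // /fam_den.
rewrite /k; ring: mulc_conj1.
Qed.

Lemma fam_dirichlet q : 0 < q -> exists f, forall j, f j = fam q j.
Proof.
move=> /fam_pole_lt1 x1; have [g gE] := mob_dirichlet nu b x1.
by exists ((fam_den q)^-1 *: g) => j; rewrite dcoefZ gE.
Qed.

Lemma fval_fam q f z : 0 < q -> (forall j, f j = fam q j) -> normc z < 1 ->
  fval f z = (q%:C + k * wmap a b z)^-1.
Proof.
move=> q0 fE z1; rewrite /wmap (fval_mob fE (fam_pole_lt1 q0) z1).
have d0 : fam_den q != 0 by rewrite -normc_gt0 fam_den_gt0.
have e0 : 1 - b * z != 0 by rewrite one_sub_neq0 // ltW.
have f0 : 1 - fam_pole q * z != 0 by rewrite one_sub_neq0 ?fam_pole_lt1 // ltW.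
have key : fam_den q * (1 - fam_pole q * z) = q%:C * (1 - b * z) + k * (1 - a * z).
  by rewrite mulrBr mulr1 /fam_pole mulrA mulrCA mulfV // mulr1 -k_eq /fam_den; ring.
have -> : q%:C + k * ((1 - a * z) / (1 - b * z)) =
    fam_den q * (1 - fam_pole q * z) / (1 - b * z) by rewrite key; field.
by field; rewrite d0 e0 f0.
Qed.

(** The coefficients of [mob] of positive index are geometric, with |x - b|^2 <= 4. The factor 2
    before [s] is j + 2 <= 2 (j + 1), from the index shift. *)
Lemma sum_dterm_fam q f s C t n : t = normc (fam_pole q) ^+ 2 -> 0 < q -> (forall j, f j = fam q j) ->
  0 <= s -> 0 <= C ->
  (forall j, j.+1%:R `^ (2 * nu) <= s * j.+1%:R + C) ->
  normc (fam_den q) ^+ 2 * \sum_(0 <= j < n) dterm nu f j <=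
  1 + 4 * (2 * s / (1 - t) ^+ 2 + C / (1 - t)).
Proof.
move=> tE q0 fE s0 C0 le_pw; have d0 := fam_den_gt0 q0.
have t1 : t < 1 by rewrite tE expr_lt1 ?normc_nneg ?fam_pole_lt1.
have t0 : 0 <= t by rewrite tE sqr_ge0.
have t01 : 0 <= t < 1 by rewrite t0.
have t1' : 0 < 1 - t by rewrite subr_gt0.
have rhs0 : 0 <= 2 * s / (1 - t) ^+ 2 + C / (1 - t).
  by rewrite addr_ge0 // divr_ge0 ?mulr_ge0 ?exprn_ge0 // ltW.
have termE j : normc (fam_den q) ^+ 2 * dterm nu f j =
    normc (mob b (fam_pole q) j) ^+ 2 * j.+1%:R `^ (2 * nu).
  rewrite /dterm fE /fam normcM normcV exprMn exprVn mulrA mulrA mulfV ?mul1r //.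
  by rewrite gt_eqF ?exprn_gt0.
rewrite mulr_sumr; under eq_bigr => j _ do rewrite termE.
case: n => [|n]; first by rewrite big_geq // addr_ge0 // mulr_ge0.
rewrite big_nat_recl // [mob _ _ 0]/= normc1 expr1n mul1r powR1 lerD2l.
have xb : normc (fam_pole q - b) ^+ 2 <= 4.
  have -> : 4 = 2 ^+ 2 :> R by rewrite -natrX.
  apply: lerXn2r; rewrite ?nnegrE ?normc_nneg //.
  by apply: le_trans (normcB _ _) _; move: b1 (fam_pole_lt1 q0); lra.
apply: le_trans (_ : \sum_(0 <= j < n) 4 * (2 * s * (j.+1%:R * t ^+ j) + C * t ^+ j) <= _).
  apply: ler_sum => j _; rewrite normcM normcX exprMn exprAC -tE -[leLHS]mulrA.
  apply: ler_pM; rewrite ?sqr_ge0 ?mulr_ge0 ?exprn_ge0 ?powR_ge0 ?normc_nneg //.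
    have -> : 2 * s * (j.+1%:R * t ^+ j) + C * t ^+ j = t ^+ j * (2 * s * j.+1%:R + C) by ring.
  apply: ler_wpM2l; first by rewrite exprn_ge0 // tE sqr_ge0.
  apply: le_trans (le_pw _) _; rewrite lerD2r [2 * s]mulrC -mulrA ler_wpM2l //.
  by rewrite -natrM ler_nat mul2n -addnn addnS ltnS leq_addr.
rewrite -mulr_sumr ler_wpM2l // big_split /= -!mulr_sumr lerD //.
  by rewrite ler_wpM2l ?mulr_ge0 // sum_succn_geo_le.
by rewrite ler_wpM2l //; apply: le_trans (sum_geo_le _ _ t01) _; rewrite expr0 div1r.
Qed.

(** Since 1 - t is at least of order q, ||f||^2 is bounded by terms of order s/q^2 and C/q. As 2 nu
    < 1, [s] may be fixed arbitrarily small first, then q. *)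
Lemma fam_small0 e : nu < 1 / 2 -> 0 < e -> exists2 d, 0 < d &
  forall q f, 0 < q < d -> (forall j, f j = fam q j) -> q * dnorm f < e.
Proof.
move=> nu12 e0; pose K := normc k ^+ 2; have K0 : 0 < K by rewrite exprn_gt0 // k_gt0.
(* With |fam_den q|^2 <= 9 for q < 1, the [s] term contributes at most e^2/8 to q^2 ||f||^2. *)
pose s := e ^+ 2 * K ^+ 2 / 144.
have s0 : 0 < s by apply: divr_gt0; [apply: mulr_gt0; exact: exprn_gt0|exact: ltr0n].
have nu1 : 2 * nu < 1 by lra.
have [C C0 le_pw] := powR_succn_split nu1 s0.
(* [c * q] collects the coefficient of index 0 and the [C] term; the choice of [d] keeps it below
   e^2/4. *)
pose c := (2 * K)^-1 + 2 * C / K.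
have c0 : 0 < c.
  apply: ltr_pwDl; first by rewrite invr_gt0 mulr_gt0.
  by apply: divr_ge0; [rewrite mulr_ge0|exact: ltW].
exists (Num.min 1 (e ^+ 2 / (4 * c))).
  by rewrite lt_min ltr01 divr_gt0 ?exprn_gt0 ?mulr_gt0.
move=> q f; rewrite lt_min => /andP[q0 /andP[q1 qc]] fE.
have d0 := fam_den_gt0 q0; pose A := normc (fam_den q) ^+ 2.
have A0 : 0 < A by rewrite exprn_gt0.
have A9 : A <= 9.
  have -> : 9 = 3 ^+ 2 :> R by rewrite -natrX.
  apply: lerXn2r; rewrite ?nnegrE ?normc_nneg //.
  by apply: le_trans (normcD _ _) _; rewrite normc_real gtr0_norm //; have := k_le2; lra.
have AqK : 2 * q * K <= A.
  have := fam_den_num q; rewrite -/A -/K.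
  have : 0 <= 1 - normc b ^+ 2 by rewrite subr_ge0 expr_le1 ?normc_nneg // ltW.
  have := sqr_ge0 (normc (q%:C * b + (a - b))); have := sqr_ge0 q; nra.
have gap := fam_pole_gap q0; rewrite -/A -/K in gap.
set t := normc (fam_pole q) ^+ 2 in gap.
have g0 : 0 < 2 * q * K / A by apply: divr_gt0 => //; do 2!apply: mulr_gt0 => //.
have t0 : 0 < 1 - t by exact: lt_le_trans gap.
have gapV : (1 - t)^-1 <= A / (2 * q * K).
  by rewrite -[leRHS]invrK invf_div lef_pV2 ?posrE.
(* The factor sqrt(1/2) makes the inequality strict; the goal becomes q^2 ||f||^2 <= e^2/2. *)
rewrite -ltr_pdivlMl //; apply: le_lt_trans (_ : _ <= e / q * (Num.sqrt (1/2))) _; last first.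
  rewrite mulrC [_^-1 * e]mulrC -[ltRHS]mul1r ltr_pM2r ?divr_gt0 //.
  by rewrite -[ltRHS]sqrtr1 ltr_sqrt //; lra.
apply: dnorm_le; first by rewrite mulr_ge0 ?sqrtr_ge0 ?divr_ge0 // ltW.
move=> n; have := sum_dterm_fam n (erefl t) q0 fE (ltW s0) C0 le_pw; rewrite -/A.
set S := \sum_(_ <= _ < _) _ => le_S.
rewrite exprMn sqr_sqrtr ?divr_ge0 // exprMn exprVn.
rewrite -(ler_pM2l A0); apply: le_trans le_S _.
have P0 : 0 < A / (2 * q * K) by rewrite -invf_div invr_gt0.
have VV : (1 - t) ^- 2 <= (A / (2 * q * K)) ^+ 2.
  by rewrite -exprVn; apply: lerXn2r; rewrite // nnegrE ?invr_ge0 ltW.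
apply: le_trans (_ : 1 + 4 * (2 * s * (A / (2 * q * K)) ^+ 2 + C * (A / (2 * q * K))) <= _).
  rewrite lerD2l ler_wpM2l //; apply: lerD; last exact: ler_wpM2l.
  by apply: ler_wpM2l VV; apply: mulr_ge0 => //; exact: ltW.
have q20 : 0 < q ^+ 2 by rewrite exprn_gt0.
rewrite -(ler_pM2r q20) mulrDl ![1 * _]mul1r.
have -> : A * (e ^+ 2 / q ^+ 2 / 2) * q ^+ 2 = A * (e ^+ 2 / 4 + e ^+ 2 / 4).
  by field; rewrite gt_eqF.
have -> : 4 * (2 * s * (A / (2 * q * K)) ^+ 2 + C * (A / (2 * q * K))) * q ^+ 2 =
    A * (A * (e ^+ 2 / 72) + 2 * C / K * q).
  by rewrite /s; field; rewrite !gt_eqF.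
have h1 : q ^+ 2 <= A * ((2 * K)^-1 * q).
  have -> : q ^+ 2 = 2 * q * K * ((2 * K)^-1 * q) by field; rewrite gt_eqF.
  apply: ler_wpM2r AqK; apply: mulr_ge0; last exact: ltW.
  by rewrite invr_ge0 ltW // mulr_gt0.
have h2 : c * q <= e ^+ 2 / 4.
  move: qc; rewrite ltr_pdivlMr ?mulr_gt0 //; lra.
have h3 : A * (e ^+ 2 / 72) <= e ^+ 2 / 8.
  apply: le_trans (_ : 9 * (e ^+ 2 / 72) <= _); last by lra.
  by rewrite ler_wpM2r // divr_ge0 // sqr_ge0.
apply: le_trans (lerD h1 (lexx _)) _; rewrite -mulrDr ler_pM2l //.
move: h2; rewrite /c mulrDl; have := sqr_ge0 e; lra.
Qed.

(** In q f - 1 the constant coefficient is -k / fam_den q and the others carry the factor x - b,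
    with x = [fam_pole q]; all are O(1/q) at a common geometric rate. *)
Lemma fam_large1 (e : R) (c1 : dirichlet_space nu) : 0 < e -> (forall j, c1 j = (j == 0%N)%:R) ->
  exists Q, forall q f, Q < q -> (forall j, f j = fam q j) ->
    [/\ 0 < q, dnorm (q%:C *: f - c1) < e & normc (fam_pole q - b) < e].
Proof.
move=> e0 c1E; pose y := (1 + normc b) / 2.
have nb := normc_nneg b; have nb1 := b1.
have y0 : 0 < y by rewrite /y; lra.
have y01 : 0 <= y < 1 by rewrite /y; lra.
have [K K0 KP] := geo_dnorm_le nu y01.
(* The three terms ensure q <= 2 |fam_den q|, the bounds by [e], and |fam_pole q| <= y,
   respectively. *)
pose Q := 4 + 18 * (K + 1) / e + 8 / (1 - normc b); exists Q => q f Qq fE.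
have p1 : 0 <= 18 * (K + 1) / e by rewrite divr_ge0 ?mulr_ge0 ?addr_ge0 ?(ltW e0).
have p2 : 0 <= 8 / (1 - normc b) by rewrite divr_ge0 // subr_ge0 ltW.
have q0 : 0 < q by apply: le_lt_trans Qq; rewrite /Q; lra.
have d0 := fam_den_gt0 q0; set A := normc (fam_den q) in d0.
have k2 := k_le2; have k0 := k_gt0.
have Aq : q - 2 <= A.
  have := normcB_ge q%:C (- k); rewrite normcNE opprK normc_real gtr0_norm // -/(fam_den q) -/A.
  lra.
have A1 : 18 * (K + 1) / e < A by move: Qq; rewrite /Q; lra.
have A2 : 8 / (1 - normc b) < A by move: Qq; rewrite /Q; lra.
have xb : normc (fam_pole q - b) <= 4 / A.
  rewrite fam_poleB // normcM normcV -/A ler_wpM2r ?invr_ge0 ?(ltW d0) //.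
  rewrite normcM a1 mul1r normcX -[leRHS](_ : 2 ^+ 2 = _ :> R); last by rewrite -natrX.
  by apply: lerXn2r; rewrite ?nnegrE ?normc_nneg.
have A3 : 18 * (K + 1) < e * A by move: A1; rewrite ltr_pdivrMr // [A * e]mulrC.
split => //; last first.
  by apply: le_lt_trans xb _; rewrite ltr_pdivrMr //; lra.
have xy : normc (fam_pole q) <= y.
  have A4 : 4 / A <= (1 - normc b) / 2.
    move: A2; rewrite ltr_pdivrMr ?subr_gt0 // ler_pdivrMr // => h; lra.
  have := normcD (fam_pole q - b) b; rewrite subrK /y; lra.
apply: le_lt_trans (_ : _ <= 18 / A * K) _; last first.
  by rewrite mulrAC ltr_pdivrMr //; lra.
apply: KP => j; rewrite dcoefB dcoefZ fE c1E /fam.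
have den0 : fam_den q != 0 by rewrite -normc_gt0.
case: j => [|m].
  rewrite mulr1 expr0 mulr1 [X in normc X](_ : _ = - k / fam_den q); last first.
    by rewrite /= /fam_den; field.
  by rewrite normcM normcNE normcV ler_wpM2r ?invr_ge0 ?(ltW d0) //; lra.
rewrite /mob subr0 !normcM normcV normc_real gtr0_norm // normcX -/A.
have q2 : q / A <= 2 by rewrite ler_pdivrMr //; move: Qq; rewrite /Q; lra.
rewrite mulrA; apply: le_trans (_ : 2 * (4 / A * y ^+ m) <= _).
  apply: ler_pM => //; rewrite ?mulr_ge0 ?invr_ge0 ?exprn_ge0 ?normc_nneg ?(ltW d0) ?(ltW q0) //.
  apply: ler_pM => //; rewrite ?exprn_ge0 ?normc_nneg //.
  by apply: lerXn2r; rewrite ?nnegrE ?normc_nneg // ltW.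
have y12 : 2^-1 <= y by rewrite /y; lra.
rewrite exprS !mulrA ler_wpM2r ?exprn_ge0 ?(ltW y0) //.
rewrite -!mulrA [A^-1 * y]mulrC !mulrA ler_wpM2r ?invr_ge0 ?(ltW d0) //.
lra.
Qed.

End Eigenfamily.

(** * Recurrence from a dense set of two-sided orbits *)

Section Recurrence.
Variables (R : realType) (nu : R) (phi : sphere R -> sphere R).
Hypothesis phi_disk : forall z : R[i], normc z < 1 ->
  exists2 w, normc w < 1 & phi (Some z) = Some w.
Implicit Types (f g : dirichlet_space nu) (x : int -> dirichlet_space nu).

Definition small (u : nat -> dirichlet_space nu) := forall e : R, 0 < e ->
  exists M, forall m, (M <= m)%N -> dnorm (u m) < e.

Lemma small_lin (c : R[i]) u v : small u -> small v -> small (fun m => c *: u m + v m).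
Proof.
move=> su sv e e0; have e20 : 0 < e / 2 by rewrite divr_gt0.
have c0 : 0 < normc c + 1 by rewrite ltr_wpDl ?normc_nneg.
have [M uM] := su _ (divr_gt0 e20 c0); have [M' vM] := sv _ e20.
exists (maxn M M') => m; rewrite geq_max => /andP[/uM um /vM vm].
apply: le_lt_trans (Defs.dnormD _ _) _; rewrite [e]splitr ltrD //.
rewrite Defs.dnormZ; move: um; rewrite ltr_pdivlMr //; apply: le_lt_trans.
by rewrite mulrC; apply: ler_wpM2l; [exact: dnorm_ge0|rewrite lerDl].
Qed.

(** The future limit [L] may differ from the past limit 0; it cancels between two late terms of the
    orbit. *)
Definition homoclinic f := exists x L, [/\ x 0 = f,
  forall k, is_comp phi (x k) (x (k + 1)),
  small (fun m => x (- m%:Z)) & small (fun m => x m%:Z - L)].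

Lemma homoclinic0 : homoclinic 0.
Proof.
have small0 : small (fun=> 0) by move=> e e0; exists 0%N => m _; rewrite dnorm0.
exists (fun=> 0), 0; split; [by []| |exact: small0|by rewrite subr0].
by move=> k; exact: is_comp0.
Qed.

Lemma homoclinic_lin (c : R[i]) f g :
  homoclinic f -> homoclinic g -> homoclinic (c *: f + g).
Proof.
move=> [x [L [<- x_orb x_past x_fut]]] [p [L' [<- p_orb p_past p_fut]]].
exists (fun k => c *: x k + p k), (c *: L + L'); split; [by []|..].
- by move=> k; apply: (is_compD phi_disk (is_compZ phi_disk c (x_orb k))); exact: p_orb.
- exact: small_lin.
- move=> e e0; have [M uM] := small_lin c x_fut p_fut e0; exists M => m /uM.
  by rewrite scalerBr opprD addrACA.
Qed.

Lemma iter_orbit x : (forall k, is_comp phi (x k) (x (k + 1))) ->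
  forall n, iter n (comp_op phi nu) (x 0) = x n%:Z.
Proof.
move=> x_orb; elim=> [//|n IHn]; rewrite iterS IHn (comp_op_eq phi_disk (x_orb n)).
by rewrite -addn1 PoszD.
Qed.

Lemma homoclinic_dense_recurrent :
  (forall f (e : R), 0 < e -> exists2 g, homoclinic g & dnorm (f - g) < e) ->
  recurrent (comp_op phi nu).
Proof.
move=> dense U oU [f Uf]; have [e e0 eU] := open_dball oU Uf.
have e40 : 0 < e / 4 by rewrite divr_gt0.
have e40' : 0 < e / 8 by rewrite divr_gt0.
have [g [x [L [og x_orb past fut]]] fg] := dense f (e / 4) e40.
have [M pastM] := past _ e40; have [M' futM'] := fut _ e40'.
(* The successor makes the return time 2m positive. *)
pose m := (maxn M M').+1.
have Mm : (M <= m)%N by rewrite leqW // leq_maxl.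
have M'm : (M' <= m)%N by rewrite leqW // leq_maxr.
have M2m : (M <= m.*2)%N by rewrite -addnn (leq_trans Mm) // leq_addr.
have M'2m : (M' <= m.*2)%N by rewrite -addnn (leq_trans M'm) // leq_addr.
(* At index 0 the last two terms lie in the far past; at index 2m the first two lie in the far
   future and their limits cancel. *)
pose p k := x k - x (k - m%:Z) + x (k - (m.*2)%:Z).
have p_orb k : is_comp phi (p k) (p (k + 1)).
  rewrite /p; apply: (is_compD phi_disk); first apply: (is_compB phi_disk).
  - exact: x_orb.
  - by rewrite addrAC; exact: x_orb.
  - by rewrite addrAC; exact: x_orb.
exists m.*2; first by rewrite double_gt0.
exists (p m.*2); split.
  exists (p 0); last exact: iter_orbit.
  apply: eU; rewrite /p og !sub0r.
  have -> : f - (g - x (- m%:Z) + x (- (m.*2)%:Z)) =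
    (f - g) + (x (- m%:Z) - x (- (m.*2)%:Z)) by rewrite !opprD opprK !addrA.
  apply: le_lt_trans (Defs.dnormD _ _) _.
  apply: lt_le_trans
    (ltrD fg (le_lt_trans (dnormB _ _) (ltrD (pastM _ Mm) (pastM _ M2m)))) _.
  by lra.
apply: eU; rewrite /p subrr og.
have -> : (m.*2)%:Z - m%:Z = m%:Z by rewrite -addnn PoszD addrK.
have -> : f - (x (m.*2)%:Z - x m%:Z + g) =
   (f - g) + ((x m%:Z - L) - (x (m.*2)%:Z - L)).
  have -> : x m%:Z - L - (x (m.*2)%:Z - L) = x m%:Z - x (m.*2)%:Z.
    by rewrite opprB addrA subrK.
  by rewrite [RHS]addrAC opprD opprB addrA.
have h1 : dnorm (x m%:Z - L) < e / 8 := futM' _ M'm.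
have h2 : dnorm (x (m.*2)%:Z - L) < e / 8 := futM' _ M'2m.
apply: le_lt_trans (Defs.dnormD _ _) _.
apply: lt_le_trans (ltrD fg (le_lt_trans (dnormB _ _) (ltrD h1 h2))) _.
by clear h1 h2 fg; lra.
Qed.

Variables (a b : R[i]) (r : R).
Hypotheses (a1 : normc a = 1) (b1 : normc b < 1) (r01 : 0 < r < 1).
Hypothesis phiW : normal_form phi a b r.

Let r0 : 0 < r. Proof. by case/andP: r01. Qed.
Let r1 : r < 1. Proof. by case/andP: r01. Qed.

(** 1 / (q + k r W) = r^(-1) / (q/r + k W). *)
Lemma fam_is_comp q f g : 0 < q -> (forall j, f j = fam a b q j) ->
  (forall j, g j = fam a b (q / r) j) -> is_comp phi f (r^-1%:C *: g).
Proof.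
move=> q0 fE gE z w z1 zw; have qr0 : 0 < q / r by rewrite divr_gt0.
have [w' w'1] := phi_disk z1; rewrite zw => -[ww']; rewrite -ww' in w'1.
rewrite fvalZ // (fval_fam a1 b1 q0 fE w'1) (fval_fam a1 b1 qr0 gE z1) (phiW z1 zw).
have rC : r%:C != 0 :> R[i] by rewrite -normc_eq0 normc_real normr_eq0 gt_eqF.
rewrite rmorphM !fmorphV -invfM; congr (_^-1); set X := wmap _ _ _.
by rewrite mulrDr mulrCA divff // mulr1 mulrCA.
Qed.

Lemma pow_large (C : R) : exists M, forall m, (M <= m)%N -> C < r^-1 ^+ m.
Proof.
have C0 : 0 < `|C| + 1 by rewrite ltr_wpDl.
have : (fun n => r ^+ n) @ \oo --> (0 : R).
  by apply: cvg_expr; rewrite ger0_norm // ltW.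
have CV : 0 < (`|C| + 1)^-1 by rewrite invr_gt0.
move=> /cvgrPdist_lt /(_ _ CV)[M _ rM]; exists M => m /rM /=.
rewrite sub0r normrN ger0_norm ?exprn_ge0 ?(ltW r0) // => lt_m.
rewrite exprVn; apply: lt_trans (_ : `|C| + 1 < _).
  by rewrite ltr_pwDr // ler_norm.
by rewrite -[ltLHS]invrK ltf_pV2 ?posrE ?exprn_gt0.
Qed.

Lemma fam_homoclinic q f : nu < 1 / 2 -> 0 < q -> (forall j, f j = fam a b q j) ->
  homoclinic f.
Proof.
move=> nu12 q0 fE.
have [F FE] : exists F : R -> dirichlet_space nu,
    forall s, 0 < s -> forall j, F s j = fam a b s j.
  suff /choice[F FE] : forall s, exists g : dirichlet_space nu,
      0 < s -> forall j, g j = fam a b s j by exists F.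
  move=> s; have [s0|s0] := ltP 0 s; last by exists 0.
  by have [g gE] := fam_dirichlet nu a1 b1 s0; exists g.
have rn0 : r != 0 by rewrite gt_eqF.
have rz0 k : 0 < r ^ k by exact: exprz_gt0.
have qk0 k : 0 < q * r ^ (- k) by rewrite mulr_gt0.
(* The factor is the parameter of [F] divided by [q], so both limits follow from the estimates on s
   F_s, with error [e * q]. *)
pose x k := (r ^ (- k))%:C *: F (q * r ^ (- k)).
have [c cE] := const_dirichlet nu.
exists x, (q^-1%:C *: c); split.
- rewrite /x oppr0 expr0z scale1r mulr1; apply: dirichlet_ext => j.
  by rewrite fE FE.
- move=> k; rewrite /x opprD (expfzDr _ _ rn0) exprN1 mulrA rmorphM -scalerA.
  apply: (is_compZ phi_disk).
  by apply: (fam_is_comp (qk0 k)) => j; rewrite FE // divr_gt0.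
- move=> e e0; have eq0 : 0 < e * q by rewrite mulr_gt0.
  have [d d0 dP] := fam_small0 a1 b1 nu12 eq0.
  have [M MP] := pow_large (q / d); exists M => m /MP lt_m.
  rewrite /x opprK -exprnP Defs.dnormZ normc_real gtr0_norm ?exprn_gt0 //.
  rewrite -(ltr_pM2l q0) [q * e]mulrC mulrA; apply: dP; last by apply: FE; rewrite mulr_gt0 ?exprn_gt0.
  rewrite mulr_gt0 ?exprn_gt0 //=; move: lt_m.
  by rewrite exprVn ltr_pdivrMr // mulrC ltr_pdivlMr ?exprn_gt0.
- move=> e e0; have eq0 : 0 < e * q by rewrite mulr_gt0.
  have [Q QP] := fam_large1 a1 b1 eq0 cE.
  have [M MP] := pow_large (Q / q); exists M => m /MP lt_m.
  rewrite /x -exprz_inv -exprnP.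
  set s := r^-1 ^+ m in lt_m *; have s0 : 0 < s by rewrite exprn_gt0 ?invr_gt0.
  have qs0 : 0 < q * s by rewrite mulr_gt0.
  have [] := QP (q * s) (F (q * s)) _ (FE _ qs0).
    by move: lt_m; rewrite ltr_pdivrMr // mulrC.
  move=> _ lt_e _; rewrite -(ltr_pM2l q0) [q * e]mulrC.
  have -> : q * dnorm (s%:C *: F (q * s) - q^-1%:C *: c) =
      dnorm (q%:C *: (s%:C *: F (q * s) - q^-1%:C *: c)).
    by rewrite Defs.dnormZ normc_real gtr0_norm.
  by rewrite scalerBr !scalerA -!rmorphM divff ?gt_eqF // scale1r.
Qed.

Lemma comp_op_recurrent : nu < 1 / 2 -> recurrent (comp_op phi nu).
Proof.
move=> nu12; apply: homoclinic_dense_recurrent.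
pose Y f := forall e : R, 0 < e -> exists2 g, homoclinic g & dnorm (f - g) < e.
have subY f : homoclinic f -> Y f by move=> hf e e0; exists f; rewrite // subrr dnorm0.
have Y0 : Y 0 by exact: subY homoclinic0.
have Ylin c f g : Y f -> Y g -> Y (c *: f + g).
  move=> Yf Yg e e0; have e20 : 0 < e / 2 by rewrite divr_gt0.
  have c0 : 0 < normc c + 1 by rewrite ltr_wpDl ?normc_nneg.
  have [f' hf' ff'] := Yf _ (divr_gt0 e20 c0); have [g' hg' gg'] := Yg _ e20.
  exists (c *: f' + g'); first exact: homoclinic_lin.
  rewrite opprD addrACA -scalerBr; apply: le_lt_trans (Defs.dnormD _ _) _.
  rewrite [e]splitr ltrD // Defs.dnormZ; move: ff'; rewrite ltr_pdivlMr //.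
  by apply: le_lt_trans; rewrite mulrC; apply: ler_wpM2l; [exact: dnorm_ge0|rewrite lerDl].
have Ycl f : (forall e, 0 < e -> exists2 g, Y g & dnorm (f - g) < e) -> Y f.
  move=> clf e e0; have e20 : 0 < e / 2 by rewrite divr_gt0.
  have [g Yg fg] := clf _ e20; have [h hh gh] := Yg _ e20; exists h => //.
  rewrite -(subrK g f) -addrA; apply: le_lt_trans (Defs.dnormD _ _) _.
  by rewrite [e]splitr ltrD.
have YZ c f : Y f -> Y (c *: f) by move=> Yf; rewrite -[_ *: _]addr0; exact: (Ylin _ _ _ Yf Y0).
have YB f g : Y f -> Y g -> Y (f - g).
  by move=> Yf Yg; rewrite addrC -scaleN1r; exact: (Ylin _ _ _ Yg Yf).
have [c cE] := const_dirichlet nu.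
have Yc : Y c.
  apply: Ycl => e e0; have [Q QP] := fam_large1 a1 b1 e0 cE.
  pose q := `|Q| + 1; have q0 : 0 < q by rewrite ltr_wpDl.
  have Qq : Q < q by rewrite ltr_pwDr // ler_norm.
  have [f fE] := fam_dirichlet nu a1 b1 q0.
  have [_ lt_e _] := QP q f Qq fE; exists (q%:C *: f); last by rewrite dnorm_distC.
  by apply/YZ/subY; exact: fam_homoclinic nu12 q0 fE.
have k0 := k_gt0 a1 b1.
apply: (zgeo_cluster_dense Y0 Ylin Ycl b1 _ Yc cE) => e e0.
have [Q QP] := fam_large1 a1 b1 e0 cE.
pose q := `|Q| + 1; have q0 : 0 < q by rewrite ltr_wpDl.
have Qq : Q < q by rewrite ltr_pwDr // ler_norm.
have [f fE] := fam_dirichlet nu a1 b1 q0.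
have [_ _ lt_e] := QP q f Qq fE.
have d0 : fam_den a b q != 0 by rewrite -normc_gt0 fam_den_gt0.
have xb : fam_pole a b q - b != 0.
  by rewrite fam_poleB // -normc_gt0 2!normcM normcV a1 mul1r normcX divr_gt0 ?exprn_gt0 // fam_den_gt0.
(* fam_den q F_q = 1 + (x - b) z / (1 - x z) with x = [fam_pole a b q], solved for z / (1 - x z). *)
exists (fam_pole a b q), ((fam_pole a b q - b)^-1 *: (fam_den a b q *: f - c)).
split; [by rewrite -subr_eq0|exact: lt_e| |].
  by apply/YZ/YB; [apply/YZ/subY; exact: fam_homoclinic nu12 q0 fE|exact: Yc].
move=> j; rewrite dcoefZ dcoefB dcoefZ fE cE /fam mulrA divff // mul1r.
case: j => [|j] /=; first by rewrite subrr mulr0.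
by rewrite subr0 mulKf.
Qed.

End Recurrence.

(** * Failure of recurrence from the critical exponent on *)

Section DiffBound.
Variables (R : realType) (nu : R).
Hypothesis nu12 : 1 / 2 <= nu.
Implicit Types (f g h : dirichlet_space nu) (u v z : R[i]).

Lemma normc_subX u v (M : R) n : normc u <= M -> normc v <= M ->
  normc (u ^+ n.+1 - v ^+ n.+1) <= normc (u - v) * (n.+1%:R * M ^+ n).
Proof.
move=> uM vM; rewrite subrXX normcM; apply: ler_wpM2l; first exact: normc_nneg.
rewrite -(big_mkord predT (fun i => u ^+ (n.+1.-1 - i) * v ^+ i)).
apply: le_trans (normc_sum _ _ _) _.
rewrite mulr_natl -[n.+1 in leRHS]subn0 -sumr_const_nat.
rewrite big_nat_cond [leRHS]big_nat_cond.
apply: ler_sum => i /andP[/andP[_ iN] _] /=.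
rewrite normcM !normcX -[in leRHS](subnK (_ : i <= n)%N) // exprD.
by apply: ler_pM; rewrite ?exprn_ge0 ?normc_nneg //; apply: lerXn2r;
  rewrite ?nnegrE ?normc_nneg ?(le_trans (normc_nneg _) uM).
Qed.

(* Cauchy-Schwarz for [sum k h_k M^(k-1)], in the form
   [2 x y <= l x^2 + y^2 / l] with [l = 1 / (E (1 - M^2))]. *)
Lemma sum_dcoef_le h (M E : R) n : 0 <= M < 1 -> 0 < E -> dnorm h <= E ->
  \sum_(0 <= j < n) normc (h j.+1) * (j.+1%:R * M ^+ j) <= E / (1 - M ^+ 2).
Proof.
move=> /andP[M0 M1] E0 hE; pose t := M ^+ 2.
have t01 : 0 <= t < 1 by rewrite sqr_ge0 expr_lt1.
have t0 : 0 < 1 - t by rewrite subr_gt0; case/andP: t01.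
pose l := (E * (1 - t))^-1; have l0 : 0 < l by rewrite invr_gt0 mulr_gt0.
apply: le_trans (_ : \sum_(0 <= j < n)
    2^-1 * (l * dterm nu h j.+1 + l^-1 * (j.+1%:R * t ^+ j)) <= _).
  apply: ler_sum => j _; set x := normc (h j.+1); set m := M ^+ j.
  have m2 : t ^+ j = m ^+ 2 by rewrite /t exprAC.
  (* Here nu >= 1/2 enters: the weight (j + 2)^(2 nu) is at least j + 1. *)
  have le_d : j.+1%:R * x ^+ 2 <= dterm nu h j.+1.
    rewrite /dterm -/x mulrC ler_wpM2l ?sqr_ge0 //.
    apply: le_trans (_ : j.+2%:R <= _); first by rewrite ler_nat.
    by rewrite -[leLHS]powRr1 //; apply: ler_powR; [rewrite ler1n|move: nu12; lra].
  apply: le_trans (_ : 2^-1 * (l * (j.+1%:R * x ^+ 2) + l^-1 * (j.+1%:R * m ^+ 2)) <= _).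
    rewrite -subr_ge0.
    have -> : 2^-1 * (l * (j.+1%:R * x ^+ 2) + l^-1 * (j.+1%:R * m ^+ 2)) -
       x * (j.+1%:R * m) = 2^-1 * j.+1%:R * l^-1 * (l * x - m) ^+ 2.
      by field; rewrite gt_eqF.
    by apply: mulr_ge0 (sqr_ge0 _); apply: mulr_ge0; [rewrite mulr_ge0 ?invr_ge0|rewrite invr_ge0 ltW].
  by rewrite m2 ler_wpM2l // lerD2r ler_wpM2l // ltW.
rewrite -mulr_sumr big_split /= -!mulr_sumr -/t.
have d1 : \sum_(0 <= j < n) dterm nu h j.+1 <= E ^+ 2.
  apply: le_trans (_ : dnorm h ^+ 2 <= _); last first.
    by apply: lerXn2r => //; rewrite nnegrE ?dnorm_ge0 // ltW.
  apply: le_trans (sum_dterm_le h n.+1); rewrite big_nat_recl //= lerDr.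
  exact: dterm_ge0.
have d2 := sum_succn_geo_le n t01.
apply: le_trans (_ : 2^-1 * (l * E ^+ 2 + l^-1 * (1 - t) ^- 2) <= _).
  apply: ler_wpM2l => //; apply: lerD; apply: ler_wpM2l => //; first exact: ltW.
  by rewrite invr_ge0 ltW.
rewrite /l invrK le_eqVlt; apply/orP; left; apply/eqP; field.
by rewrite !gt_eqF.
Qed.

(** The constant terms cancel and each difference of powers yields a factor |u - v|. [E] is any
    positive bound of the norm, since [sum_dcoef_le] divides by it. *)
Lemma fval_diff_le h u v (M E : R) : normc u <= M -> normc v <= M -> M < 1 ->
  0 < E -> dnorm h <= E ->
  normc (fval h u - fval h v) <= normc (u - v) * (E / (1 - M ^+ 2)).
Proof.
move=> uM vM M1 E0 hE; have M0 : 0 <= M by exact: le_trans (normc_nneg _) uM.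
have M01 : 0 <= M < 1 by rewrite M0.
have uT := fval_tends h (le_lt_trans uM M1).
have vT := fval_tends h (le_lt_trans vM M1).
have dT := tendsD uT (tendsZ (-1) vT); rewrite mulN1r in dT.
apply/ler_addgt0Pr => s s0; have [N uN] := dT s s0.
have := uN N.+1 (leqnSn _); set P := (X in normc (X - _)) => lt_s.
rewrite -[X in normc X](subKr P).
apply: le_trans (normcB _ _) _; apply: lerD (ltW lt_s).
have -> : P = \sum_(0 <= j < N) h j.+1 * (u ^+ j.+1 - v ^+ j.+1).
  rewrite /P /= mulN1r !big_nat_recl // !expr0 opprD addrACA subrr add0r.
  by rewrite -sumrB; apply: eq_bigr => j _; rewrite mulrBr.
apply: le_trans (normc_sum _ _ _) _.
apply: le_trans (_ : \sum_(0 <= j < N)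
  normc (u - v) * (normc (h j.+1) * (j.+1%:R * M ^+ j)) <= _).
  apply: ler_sum => j _; rewrite normcM mulrCA ler_wpM2l ?normc_nneg //.
  exact: normc_subX.
by rewrite -mulr_sumr ler_wpM2l ?normc_nneg // sum_dcoef_le.
Qed.

End DiffBound.

(** * Two points whose images contradict recurrence *)

Section Nonrecurrence.
Variables (R : realType) (nu : R) (phi : sphere R -> sphere R).
Hypothesis phi_disk : forall z : R[i], normc z < 1 ->
  exists2 w, normc w < 1 & phi (Some z) = Some w.
Variables (a b : R[i]) (r : R).
Hypotheses (a1 : normc a = 1) (b1 : normc b < 1) (r01 : 0 < r < 1).
Implicit Types (z w V : R[i]) (f g : dirichlet_space nu).

Hypothesis phiW : normal_form phi a b r.

Let b1w : normc b <= 1. Proof. exact: ltW. Qed.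

(** Once the default value 0 occurs, all later iterates are 0; otherwise [w] is the n-th image of
    [z] under phi. *)
Lemma iter_comp_op f n : iter n (comp_op phi nu) f = 0 \/
  forall z, normc z < 1 -> exists w, [/\ normc w < 1,
    wmap a b w = (r ^+ n)%:C * wmap a b z &
    fval (iter n (comp_op phi nu) f) z = fval f w].
Proof.
elim: n => [|n IHn]; first by right=> z z1; exists z; rewrite expr0 mul1r.
rewrite iterS; set g := iter _ _ _ in IHn *.
case: IHn => [->|IHn]; first by left; exact: comp_op0.
have [gT|] := comp_op_or phi g; last by left.
right=> z z1; have [w w1 zw] := phi_disk z1; have [v [v1 vw vE]] := IHn w w1.
exists v; split; [exact: v1| |by rewrite (gT z w z1 zw) vE].
by rewrite vw (phiW z1 zw) exprSr rmorphM mulrA.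
Qed.

Lemma normc_one_sub_le2 z : normc z < 1 -> normc (1 - b * z) <= 2.
Proof.
move=> z1; apply: le_trans (normcB _ _) _; rewrite normc1 normcM.
have := b1; have := normc_nneg b; have := normc_nneg z; nra.
Qed.

Lemma normc_one_sub_ge z : normc z < 1 -> 1 - normc b <= normc (1 - b * z).
Proof.
move=> z1; apply: le_trans (normcB_ge _ _); rewrite normc1 normcM.
have := b1; have := normc_nneg b; have := normc_nneg z; nra.
Qed.

(** Under scaling by s the gap shrinks at most by the factor s. Passing between gap and 1 - |z|^2
    costs |1 - b z|, which lies between 1 - |b| and 2. *)
Lemma boundary_dist_ge z w (s : R) : normc z < 1 -> normc w < 1 -> 0 <= s <= 1 ->
  wmap a b w = s%:C * wmap a b z ->
  s * ((1 - normc b) ^+ 2 * (1 - normc z ^+ 2) / 4) <= 1 - normc w ^+ 2.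
Proof.
move=> z1 w1 s01 wz; have /andP[s0 s1] := s01; have ab0 : 0 < normc (a - b) by rewrite -(k_eq b a1) normcM a1 mulr1 k_gt0.
rewrite -(@ler_pM2l _ (normc (a - b) ^+ 2)) ?exprn_gt0 // -(wgap_wmap _ b1w) // wz.
have gz : normc (a - b) ^+ 2 * (1 - normc z ^+ 2) / 4 <= wgap a b (wmap a b z).
  have d0 : 0 < normc (1 - b * z) by rewrite normc_gt0 one_sub_neq0 // ltW.
  rewrite -(wgap_wmap _ b1w) // ler_pdivrMr // mulrC.
  apply: ler_wpM2l.
    rewrite -(@pmulr_rge0 _ (normc (1 - b * z) ^+ 2)) ?exprn_gt0 // (wgap_wmap _ b1w) //.
    by rewrite mulr_ge0 ?sqr_ge0 // subr_ge0 expr_le1 ?normc_nneg // ltW.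
  have -> : 4 = 2 ^+ 2 :> R by rewrite -natrX.
  by apply: lerXn2r; rewrite ?nnegrE ?normc_nneg // normc_one_sub_le2.
have gw : s * (normc (a - b) ^+ 2 * (1 - normc z ^+ 2) / 4) <= wgap a b (s%:C * wmap a b z).
  by apply: le_trans (wgap_scale a1 b1w _ s01); rewrite ler_wpM2l.
have -> : normc (a - b) ^+ 2 * (s * ((1 - normc b) ^+ 2 * (1 - normc z ^+ 2) / 4)) =
  (1 - normc b) ^+ 2 * (s * (normc (a - b) ^+ 2 * (1 - normc z ^+ 2) / 4)) by field.
apply: ler_pM => //; first exact: sqr_ge0.
  rewrite mulr_ge0 // divr_ge0 // mulr_ge0 ?sqr_ge0 //.
  by rewrite subr_ge0 expr_le1 ?normc_nneg // ltW.
apply: lerXn2r; rewrite ?nnegrE ?normc_nneg ?subr_ge0 ?(ltW b1) //.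
exact: normc_one_sub_ge.
Qed.

Let subrACA (x y z t : R[i]) : (x - y) - (z - t) = (x - z) - (y - t).
Proof. by rewrite opprD addrACA -opprD. Qed.

(** Applied with x, y the values of f at the image points and z, t the values of W at the original
    ones: the first bracket compares W with the iterate, the second f with W at the images. *)
Let damped_difference (s x y z t : R[i]) :
  (1 - s) * (z - t) = (z - t - (x - y)) + (x - s * z - (y - s * t)).
Proof. by ring. Qed.

Lemma comp_op_not_recurrent : 1 / 2 <= nu -> ~ recurrent (comp_op phi nu).
Proof.
move=> nu12 rec; have /andP[r0 r1] := r01; have ab0 : 0 < normc (a - b) by rewrite -(k_eq b a1) normcM a1 mulr1 k_gt0.
pose z1 : R[i] := (2^-1)%:C.
have z1n : normc z1 = 2^-1 by rewrite normc_real gtr0_norm.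
have z1d : normc z1 < 1 by rewrite z1n; lra.
have z0d : normc (0 : R[i]) < 1 by rewrite normc0.
pose D := normc (wmap a b z1 - wmap a b 0).
have D0 : 0 < D.
  rewrite normc_gt0; apply/eqP => e0; have := wmapB a b1w z1d z0d.
  rewrite e0 mul0r subr0 => /esym/eqP; rewrite -normc_eq0 normcM z1n normcC.
  by rewrite mulf_eq0 !gt_eqF.
(* The constant of [boundary_dist_ge] at 1/2, where 1 - |z|^2 = 3/4; it serves for the point 0 as
   well. *)
pose c := (1 - normc b) ^+ 2 * (3 / 4) / 4.
have c0 : 0 < c by rewrite divr_gt0 // mulr_gt0 ?divr_gt0 // exprn_gt0 // subr_gt0.
(* The images are at distance at most 4 s D / |a - b|, and 1 - M^2 >= s c; in the quotient [s]
   cancels. *)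
pose K := 4 * D / (normc (a - b) * c).
have K0 : 0 < K by rewrite divr_gt0 // mulr_gt0.
(* Recurrence on the ball of radius [E] would give (1 - r) D <= (1 - s) D <= E (K + 1) = (1 - r) D /
   2. *)
pose E := (1 - r) * D / (2 * (K + 1)).
have K1 : 0 < K + 1 by rewrite addr_gt0.
have E0 : 0 < E by apply: divr_gt0; apply: mulr_gt0 => //; rewrite subr_gt0.
have EK : E * (K + 1) = (1 - r) * D / 2 by rewrite /E; field; rewrite gt_eqF.
have [f0 f0E] := mob_dirichlet nu a b1.
have f0V z : normc z < 1 -> fval f0 z = wmap a b z.
  by move=> zd; rewrite (@fval_mob _ _ f0 1 a b) ?mul1r // => j; rewrite mul1r.
have near g : dnorm (f0 - g) < E ->
    normc ((wmap a b z1 - wmap a b 0) - (fval g z1 - fval g 0)) <= E.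
  move=> gE.
  have h0 : normc (0 : R[i]) <= 2^-1 by rewrite normc0 invr_ge0.
  have h1 : (2^-1 : R) < 1 by lra.
  have z1le : normc z1 <= 2^-1 by rewrite z1n.
  have := fval_diff_le nu12 z1le h0 h1 E0 (ltW gE).
  rewrite subr0 z1n (fvalB f0 g z1d) (fvalB f0 g z0d) (f0V _ z1d) (f0V _ z0d) => h.
  rewrite [X in normc X](_ : _ = wmap a b z1 - fval g z1 - (wmap a b 0 - fval g 0)).
    apply: le_trans h _; rewrite mulrCA ler_piMr ?(ltW E0) //.
    have -> : (1 - 2^-1 ^+ 2)^-1 = 4 / 3 :> R by field.
    by lra.
  exact: subrACA.
pose U := [set g | dnorm (f0 - g) < E].
have oU : open U by exact: dball_open.
have U0 : U !=set0 by exists f0; rewrite /U /= subrr dnorm0.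
have [n n0 [_ [[f Uf <-] Ug]]] := rec U oU U0.
have := near _ Ug; case: (iter_comp_op f n) => [->|gf].
  rewrite (fval0 nu z1d) (fval0 nu z0d) subrr subr0 -/D => DE.
  clear near.
  have : E * 1 <= E * (K + 1) by rewrite ler_pM2l // lerDr ltW.
  rewrite EK; nra.
set s := r ^+ n in gf.
have s0 : 0 < s by rewrite exprn_gt0.
have sr : s <= r by rewrite /s -[leRHS]expr1 ler_wiXn2l // ltW.
have s01 : 0 <= s <= 1 by rewrite ltW //= (le_trans sr) // ltW.
have [w1 [w1d w1W ->]] := gf z1 z1d; have [w0 [w0d w0W ->]] := gf 0 z0d.
have b1' : s * c <= 1 - normc w1 ^+ 2.
  apply: le_trans (boundary_dist_ge z1d w1d s01 w1W); rewrite ler_pM2l // z1n /c.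
  by rewrite (_ : 1 - 2^-1 ^+ 2 = 3 / 4 :> R) //; field.
have b0' : s * c <= 1 - normc w0 ^+ 2.
  apply: le_trans (boundary_dist_ge z0d w0d s01 w0W); rewrite ler_pM2l // normc0 /c.
  rewrite expr0n subr0 ler_wpM2r ?invr_ge0 // ler_wpM2l ?sqr_ge0 //.
  by rewrite ler_pdivrMr // mul1r ler_nat.
pose M := Num.max (normc w1) (normc w0).
have M1 : M < 1 by rewrite gt_max w1d.
have bM : s * c <= 1 - M ^+ 2 by rewrite /M; case: (leP (normc w1) (normc w0)).
have sc0 : 0 < s * c by rewrite mulr_gt0.
have dw : normc (a - b) * normc (w1 - w0) <= 4 * s * D.
  rewrite [normc (a - b)]normcC -normcM -(wmapB a b1w w1d w0d) w1W w0W -mulrBr.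
  rewrite normcM [normc (s%:C * _)]normcM normc_real gtr0_norm // -/D normcM.
  have : normc (1 - b * w1) * normc (1 - b * w0) <= 2 * 2.
    by apply: ler_pM; rewrite ?normc_nneg ?normc_one_sub_le2.
  rewrite -natrM => h; have -> : 4 * s * D = s * D * 4 by ring.
  apply: ler_wpM2l h.
  by rewrite mulr_ge0 ?(ltW s0) ?(ltW D0).
have diff : normc (fval (f - f0) w1 - fval (f - f0) w0) <= K * E.
  have fE : dnorm (f - f0) <= E by rewrite dnorm_distC ltW.
  have := @fval_diff_le _ _ nu12 (f - f0) w1 w0 M E.
  rewrite !le_max !lexx orbT => /(_ isT isT M1 E0 fE) h; apply: le_trans h _.
  apply: le_trans (_ : normc (w1 - w0) * (E / (s * c)) <= _).
    rewrite ler_wpM2l ?normc_nneg // ler_wpM2l ?(ltW E0) // lef_pV2 ?posrE //.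
    exact: lt_le_trans bM.
  have : normc (w1 - w0) <= 4 * s * D / normc (a - b) by rewrite ler_pdivlMr // mulrC.
  move=> h; apply: le_trans (ler_wpM2r _ h) _; first by rewrite divr_ge0 // ltW.
  rewrite le_eqVlt; apply/orP; left; apply/eqP; rewrite /K; field.
  by rewrite !gt_eqF.
have Dw : normc ((1 - s)%:C * (wmap a b z1 - wmap a b 0)) = (1 - s) * D.
  rewrite normcM normc_real ger0_norm // subr_ge0.
  by case/andP: s01.
rewrite (fvalB f f0 w1d) (fvalB f f0 w0d) (f0V _ w1d) (f0V _ w0d) w1W w0W in diff.
move=> near_g.
have sD : (1 - s) * D <= E + K * E.
  rewrite -Dw rmorphB /= (damped_difference _ (fval f w1) (fval f w0)).
  by apply: le_trans (normcD _ _) _; exact: lerD.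
clear near_g diff dw near gf.
have : (1 - r) * D <= (1 - s) * D by rewrite ler_pM2r // lerB.
have : 0 < (1 - r) * D by rewrite mulr_gt0 // subr_gt0.
by move: EK; lra.
Qed.

End Nonrecurrence.

Theorem theorem2p7 (R : realType) (phi : sphere R -> sphere R) (nu : R) :
  linear_fractional phi ->
  phi @` disk R `<=` disk R ->
  (forall p, disk R p -> phi p <> p) ->
  hyperbolic phi ->
  ~ disk_automorphism phi ->
  recurrent (comp_op phi nu) <-> nu < 1 / 2.
Proof.
move=> phi_lf phi_sub phi_fix phi_hyp phi_naut.
have phi_disk z : normc z < 1 -> exists2 w, normc w < 1 & phi (Some z) = Some w.
  move=> z1; have [|w w1 <-] := phi_sub (phi (Some z)).
    by exists (Some z) => //; exists z; rewrite //= normc_lt1.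
  by exists w; rewrite // -normc_lt1.
have phi_nofix z : normc z < 1 -> phi (Some z) <> Some z.
  by move=> z1; apply: phi_fix; exists z; rewrite //= normc_lt1.
have [a [b [r [a1 b1 r01 nf]]]] :=
  hyperbolic_normal_form phi_lf phi_disk phi_nofix phi_naut phi_hyp.
split=> [rec|nu12]; last exact: comp_op_recurrent nf nu12.
rewrite ltNge; apply/negP => nu12.
exact: comp_op_not_recurrent nf nu12 rec.
Qed.
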